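(* For any integers $q\geq 2$ and $t\geq 3$, the complete graph $K_t$ is $s_q$-abundant.
   Context: Graphs are finite and simple. For graphs $G,H$ and an integer $q\geq 2$, $G$ is $q$-Ramsey for $H$ (written $G\rightarrow_q H$) if every coloring of the edges of $G$ with $q$ colors contains a monochromatic copy of $H$, i.e. a subgraph of $G$ (not necessarily induced) isomorphic to $H$ all of whose edges have the same color. $G$ is minimal $q$-Ramsey for $H$ if $G\rightarrow_q H$ and no proper subgraph $G'\subsetneq G$ satisfies $G'\rightarrow_q H$; $\mathcal{M}_q(H)$ denotes the set of all minimal $q$-Ramsey graphs for $H$. With $\delta(G)$ the minimum degree of $G$, set $s_q(H)=\min\{\delta(G): G\in\mathcal{M}_q(H)\}$. A graph $H$ is $s_q$-abundant if for every $k\geq 1$ there exists a minimal $q$-Ramsey graph for $H$ with at least $k$ vertices of degree $s_q(H)$. *)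

(* Defs.v *)
From mathcomp Require Import all_boot.

Set Implicit Arguments.
Unset Strict Implicit.
Unset Printing Implicit Defensive.

Record sgraph := SGraph {
  vertex :> finType;
  adj : rel vertex;
  adj_sym : symmetric adj;
  adj_irr : irreflexive adj }.

Arguments adj {s}.

Definition degree (G : sgraph) (v : G) : nat := #|[set w | adj v w]|.

Definition isomorphic (G H : sgraph) : Prop :=
  exists f : G -> H, bijective f /\ forall x y, adj (f x) (f y) = adj x y.

(* Vertex set and edge relation can both shrink: not necessarily induced, not
   necessarily spanning. *)
Record subgraph (G : sgraph) := Subgraph {
  sub_vertices : {set G};
  sub_adj : rel G;
  sub_adj_sym : symmetric sub_adj;
  sub_adj_adj : forall x y, sub_adj x y -> adj x y;
  sub_adj_vertices : forall x y, sub_adj x y -> x \in sub_vertices }.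

Section GraphOfSubgraph.
Variables (G : sgraph) (S : subgraph G).

Let T : finType := {x : G | x \in sub_vertices S}.
Let e : rel T := fun x y => sub_adj S (val x) (val y).

Fact subgraph_sym : symmetric e.
Proof. by move=> x y; apply: sub_adj_sym. Qed.

Fact subgraph_irr : irreflexive e.
Proof.
by move=> x; apply/negP => /(@sub_adj_adj _ S); rewrite adj_irr.
Qed.

Definition graph_of_subgraph : sgraph := SGraph subgraph_sym subgraph_irr.
End GraphOfSubgraph.

Coercion graph_of_subgraph : subgraph >-> sgraph.

Definition proper_subgraph (G : sgraph) (S : subgraph G) : Prop :=
  ~ (sub_vertices S = [set: G] /\ forall x y, sub_adj S x y = adj x y).

(* An edge colouring is given as a function on all vertex sets, of which only
   the values at the edges [set x; y] are used. *)
Definition monochromatic (q : nat) (G : sgraph) (c : {set G} -> 'I_q)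
    (S : subgraph G) : Prop :=
  exists a : 'I_q, forall x y, sub_adj S x y -> c [set x; y] = a.

Definition ramsey (q : nat) (G H : sgraph) : Prop :=
  forall c : {set G} -> 'I_q,
    exists S : subgraph G, isomorphic S H /\ monochromatic c S.

Definition minimal_ramsey (q : nat) (G H : sgraph) : Prop :=
  ramsey q G H /\ forall S : subgraph G, proper_subgraph S -> ~ ramsey q S H.

Definition is_min (P : nat -> Prop) (m : nat) : Prop :=
  P m /\ forall n, P n -> m <= n.

(* is_min_degree G d says "delta(G) = d"; the graph with no vertex has no
   minimum degree. *)
Definition is_min_degree (G : sgraph) : nat -> Prop :=
  is_min (fun d => exists v : G, degree v = d).

(* is_s q H s says "s_q(H) = s". *)
Definition is_s (q : nat) (H : sgraph) : nat -> Prop :=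
  is_min (fun d => exists G : sgraph, minimal_ramsey q G H /\ is_min_degree G d).

Definition s_abundant (q : nat) (H : sgraph) : Prop :=
  exists s : nat, is_s q H s /\
    forall k : nat, 1 <= k ->
      exists G : sgraph,
        minimal_ramsey q G H /\ k <= #|[set v : G | degree v == s]|.

Section CompleteGraph.
Variable t : nat.
Let e : rel 'I_t := fun x y => x != y.

Fact complete_sym : symmetric e.
Proof. by move=> x y; rewrite /e eq_sym. Qed.

Fact complete_irr : irreflexive e.
Proof. by move=> x; rewrite /e eqxx. Qed.

Definition complete_graph : sgraph := SGraph complete_sym complete_irr.
End CompleteGraph.

(* Main.v *)
Require Import Defs.
From mathcomp Require Import all_boot.
From mathcomp Require Import perm zify.
From Stdlib Require Import Classical.

(** Call a colouring of the edges of a graph good if it has no monochromatic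
    [K_t]; a graph is Ramsey exactly when it has no good colouring.

    Everything rests on the fact that glueing graphs along a common induced
    subgraph creates no clique, so that good colourings which agree on the
    common part glue together.  Hence the conditions on the colouring of a graph
    [B] which can be enforced by embedding [B] as an induced subgraph into a
    larger graph ([enforceable]) are closed under conjunction, under pulling back
    along induced embeddings and under projection.

    The heart of the proof is that one can enforce that two edges [zu], [zw] with
    [u] and [w] not adjacent get different colours.  Let [K_n] be the largest
    complete graph with a good colouring.  No star at a vertex of [K_n] is
    monochromatic in a good colouring, since a twin of that vertex would give a
    good colouring of [K_(n+1)].  The leaves of this star are adjacent to each
    other; a partite amalgamation replaces it by an induced star that is never
    monochromatic in some graph having good colourings ([never_mono_star_exists]).
    Copies of that graph, glued onto a large star along all sets of leaves of the
    right size, leave no good colouring.  Removing copies, and then splitting off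
    leaves of one copy one at a time, there is a last moment without good colouring;
    just after it, the leaf split off last and the leaf it came from must get
    different colours.  Equality is enforced from inequality with [q - 1] auxiliary
    edges at [z], and paths carry both relations to two arbitrary edges of an
    arbitrary graph ([enforceable_two_edges]).

    Now let [A] be a graph with a good colouring [c] that cannot be extended to a
    new vertex joined to all of [A], and suppose that some other good colouring of
    [A] can be extended.  Add [q] isolated edges of distinct colours as a palette,
    and forbid one by one, for each edge of [A], the palette colours different from
    the one given by [c].  When all of them are forbidden, a vertex [v] joined to [A]
    leaves no good colouring; at the first step where this happens one gets a
    constraint graph in which [v] forces two edges to have equal colours,
    while without [v] they may also differ ([switch_gadget]).  A chain of [k] such
    gadgets whose two ends must differ is Ramsey and needs each of its [k] vertices
    [v]; these have degree [|A|], and they all survive in every minimal Ramsey subgraph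
    ([many_essential_vertices]).

    For a lexicographic product colouring of the complete graph on [(t-1)^q]
    vertices, this gives [s_q(K_t) <= (t-1)^q].  For the neighbourhood [A] of a
    vertex of degree [s_q(K_t)] in a minimal Ramsey graph, it gives the theorem:
    the other good colouring exists because the complete graph on [(t-1)^q + 1]
    vertices has a good colouring, and a surviving vertex has degree at most [|A|],
    hence exactly [s_q(K_t)] by minimality. *)

Set Implicit Arguments.
Unset Strict Implicit.
Unset Printing Implicit Defensive.

(** * Preliminaries *)

Lemma pigeonhole (T C : finType) (f : T -> C) m :
  #|C| * m < #|T| -> exists a, m < #|[set x | f x == a]|.
Proof.
move=> lt_m; apply: NNPP => noa; move: lt_m; rewrite ltnNge => /negP; apply.
rewrite -sum1_card (partition_big f predT) //= -sum_nat_const.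
apply: leq_sum => a _; rewrite sum1_card leqNgt; apply/negP => lt_m.
by apply: noa; exists a; rewrite cardsE.
Qed.

Lemma injection_into (T U : finType) (A : {set U}) :
  #|T| <= #|A| -> exists2 f : T -> U, injective f & forall x, f x \in A.
Proof.
move=> leTA; exists (fun x => enum_val (widen_ord leTA (enum_rank x))).
  move=> x y /enum_val_inj /(congr1 val) /= /val_inj; exact: enum_rank_inj.
by move=> x; apply: enum_valP.
Qed.

(** Locates a single element of a sequence of constraints that can be blamed for
    making them unsatisfiable. *)
Lemma critical_suffix (T : Type) (P : seq T -> Prop) (s : seq T) :
  P [::] -> ~ P s ->
  exists s1 k s2, [/\ s = s1 ++ k :: s2, P s2 & ~ P (k :: s2)].
Proof.
elim: s => [|k s IH] P0 nP; first by case: nP.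
have [Ps|nPs] := classic (P s); first by exists [::], k, s.
by have [s1 [k' [s2 [-> ? ?]]]] := IH P0 nPs; exists (k :: s1), k', s2.
Qed.

Lemma injection_two_points (T : finType) (a b a' b' : T) : a != b -> a' != b' ->
  exists s : T -> T, [/\ injective s, s a = a' & s b = b'].
Proof.
move=> ab a'b'; pose b1 := tperm a a' b.
have b1a' : b1 != a' by rewrite /b1 -[X in _ != X](tpermL a a') (inj_eq perm_inj) eq_sym.
exists (fun x => tperm b1 b' (tperm a a' x)); split=> [x y /perm_inj/perm_inj//||].
  by rewrite tpermL tpermD // eq_sym.
by rewrite tpermL.
Qed.

(** * Colourings without monochromatic cliques *)

Section Colourings.
Variables q t : nat.

(** Colours are attached to ordered pairs of vertices, so that colourings pull
    back along maps; symmetry is part of the definition of a good colouring. *)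
Definition colouring (G : sgraph) := G -> G -> 'I_q.

Definition mono_clique (G : sgraph) (c : colouring G) (a : 'I_q) (A : {set G}) :=
  {in A &, forall x y, x != y -> adj x y /\ c x y = a}.

Definition good (G : sgraph) (c : colouring G) :=
  (forall x y, c x y = c y x) /\
  forall a (A : {set G}), mono_clique c a A -> #|A| < t.

Definition colourable (G : sgraph) := exists c : colouring G, good c.

Definition embedding (G H : sgraph) (h : G -> H) :=
  injective h /\ forall x y, adj (h x) (h y) = adj x y.

Definition pull (G H : sgraph) (h : G -> H) (c : colouring H) : colouring G :=
  fun x y => c (h x) (h y).

Definition agree (G : sgraph) (c d : colouring G) :=
  forall x y, adj x y -> c x y = d x y.

Lemma mono_clique_image (G H : sgraph) (h : G -> H) c a A :
  (forall x y, adj x y -> adj (h x) (h y)) ->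
  mono_clique (pull h c) a A -> mono_clique c a (h @: A).
Proof.
move=> hh mA _ _ /imsetP[x xA ->] /imsetP[y yA ->] ne.
have nxy : x != y by apply: contraNneq ne => ->.
by have [axy cxy] := mA x y xA yA nxy; split; first exact: hh.
Qed.

Lemma good_pull (G H : sgraph) (h : G -> H) c :
  injective h -> (forall x y, adj x y -> adj (h x) (h y)) ->
  good c -> good (pull h c).
Proof.
move=> hI hh [cS cA]; split=> [x y|a A mA]; first exact: cS.
by rewrite -(card_imset _ hI); apply: (cA a); apply: mono_clique_image.
Qed.

Lemma good_pull_emb (G H : sgraph) (h : G -> H) c :
  embedding h -> good c -> good (pull h c).
Proof. by move=> [hI hh]; apply: good_pull => // x y; rewrite hh. Qed.

Lemma mono_clique_agree (G : sgraph) (c d : colouring G) a A :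
  agree c d -> mono_clique c a A -> mono_clique d a A.
Proof.
move=> cd mA x y xA yA nxy; have [axy cxy] := mA x y xA yA nxy.
by split=> //; rewrite -cd.
Qed.

Lemma good_recolour (G : sgraph) (s : 'I_q -> 'I_q) (c : colouring G) :
  injective s -> good c -> good (fun x y => s (c x y)).
Proof.
move=> sI [cS cA]; have [s' sK s'K] := injF_bij sI.
split=> [x y|a A mA]; first by rewrite cS.
apply: (cA (s' a)) => x y xA yA nxy; have [xy <-] := mA x y xA yA nxy.
by rewrite sK.
Qed.

Hypotheses (q_gt1 : 1 < q) (t_gt2 : 2 < t).

Definition colour0 : 'I_q := Ordinal (ltnW q_gt1).

Lemma triangle_free_good (G : sgraph) (c : colouring G) :
  (forall x y, c x y = c y x) ->
  (forall x y z : G, adj x y -> adj y z -> adj x z -> False) -> good c.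
Proof.
move=> cS tf; split=> // a A mA; apply: leq_ltn_trans t_gt2.
rewrite leqNgt; apply/negP => /card_gt2P[x [y [z [[xA yA zA] [nxy nyz nzx]]]]].
apply: (tf x y z); [by case: (mA x y)| by case: (mA y z)|].
by rewrite eq_sym in nzx; case: (mA x z).
Qed.

(** * Glueing along a common induced subgraph *)

(** The graph [attach] is the base [B] together with one copy of [V] for each
    [i : I]; the port [D] of the copy is identified with its image in [B]
    under [h i].  Port vertices of the copies are kept as isolated vertices, so
    that the vertex type is a plain sum. *)
Section Attach.
Variables (B D V : sgraph) (I : finType) (j : D -> V) (h : I -> D -> B).
Hypotheses (jE : embedding j) (hE : forall i, embedding (h i)).

Definition attach_vertex : finType := (B + I * V)%type.

Definition attach_in (i : I) (x : V) : attach_vertex :=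
  if [pick p | j p == x] is Some p then inl (h i p) else inr (i, x).

Lemma attach_in_port i p : attach_in i (j p) = inl (h i p).
Proof.
rewrite /attach_in; case: pickP => [p' /eqP/(proj1 jE)->//|/(_ p)].
by rewrite eqxx.
Qed.

Variant attach_in_spec i x : attach_vertex -> Type :=
| AttachPort p of x = j p : attach_in_spec i x (inl (h i p))
| AttachNew of (forall p, x <> j p) : attach_in_spec i x (inr (i, x)).

Lemma attach_inP i x : attach_in_spec i x (attach_in i x).
Proof.
rewrite /attach_in; case: pickP => [p /eqP<-|np]; first by constructor.
by constructor=> p xp; have := np p; rewrite xp eqxx.
Qed.

Lemma attach_in_inj i : injective (attach_in i).
Proof.
move=> x y; case: attach_inP => [p ->|_]; case: attach_inP => [p' ->|_] //.
  by case=> /(proj1 (hE i))->.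
by case.
Qed.

Lemma attach_in_inr i i' x v : attach_in i x = inr (i', v) -> i = i' /\ x = v.
Proof. by case: attach_inP => // _ []. Qed.

Definition attach_adj (a b : attach_vertex) : bool :=
  match a, b with
  | inl x, inl y => adj x y
  | _, _ => [exists i, exists x, exists y,
               [&& attach_in i x == a, attach_in i y == b & adj x y]]
  end.

Lemma attach_adj_sym : symmetric attach_adj.
Proof.
have sw (a b : attach_vertex) : [exists i, exists x, exists y,
    [&& attach_in i x == a, attach_in i y == b & adj x y]] ->
  [exists i, exists x, exists y,
    [&& attach_in i x == b, attach_in i y == a & adj x y]].
  move=> /existsP[i /existsP[x /existsP[y /and3P[xa yb xy]]]].
  by apply/existsP; exists i; apply/existsP; exists y; apply/existsP; exists x;
     rewrite xa yb adj_sym.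
move=> [x|u] [y|v] /=; first exact: adj_sym.
all: by apply/idP/idP => /sw.
Qed.

Lemma attach_adj_irr : irreflexive attach_adj.
Proof.
move=> [x|u]; first exact: adj_irr.
apply/negbTE/negP => /existsP[i /existsP[x /existsP[y /and3P[/eqP xa /eqP]]]].
by rewrite -xa => /attach_in_inj->; rewrite adj_irr.
Qed.

Definition attach : sgraph := SGraph attach_adj_sym attach_adj_irr.

Lemma inl_embedding : embedding (inl : B -> attach).
Proof. by split=> // x y []. Qed.

Lemma attach_adj_inr i (x : V) (b : attach) :
  @adj attach (inr (i, x)) b ->
  exists2 y, b = attach_in i y & attach_in i x = inr (i, x) /\ adj x y.
Proof.
move=> /= /existsP[i' /existsP[x' /existsP[y /and3P[/eqP xa /eqP<- xy]]]].
by have [ei ex] := attach_in_inr xa; subst; exists y.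
Qed.

Lemma attach_in_embedding i : embedding (attach_in i : V -> attach).
Proof.
split; first exact: attach_in_inj.
have aux x y : adj x y -> @adj attach (attach_in i x) (attach_in i y).
  move=> xy; rewrite /adj /=; case ex: (attach_in i x) => [x'|u]; last first.
    rewrite /= -ex; apply/existsP; exists i; apply/existsP; exists x.
    by apply/existsP; exists y; rewrite !eqxx.
  case ey: (attach_in i y) => [y'|v]; last first.
    rewrite /= -ex -ey; apply/existsP; exists i; apply/existsP; exists x.
    by apply/existsP; exists y; rewrite !eqxx.
  move: ex ey; case: attach_inP => // p xp [<-]; case: attach_inP => // p' yp [<-].
  by rewrite /= (proj2 (hE i)) -(proj2 jE) -xp -yp.
move=> x y; apply/idP/idP; last exact: aux.
case: (attach_inP i x) => [p ->|npx]; last first.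
  case/attach_adj_inr=> v ev [_ xv].
  have /(@attach_in_inj i)-> // : attach_in i y = attach_in i v by [].
case: (attach_inP i y) => [p' ->|npy].
  by rewrite (proj2 inl_embedding) (proj2 (hE i)) (proj2 jE).
rewrite adj_sym => /attach_adj_inr[v ev [_ yv]].
have /(@attach_in_inj i) -> : attach_in i (j p) = attach_in i v by rewrite attach_in_port.
by rewrite adj_sym.
Qed.

Variables (cB : colouring B) (cV : I -> colouring V).
Hypotheses (gB : good cB) (gV : forall i, good (cV i)).
Hypothesis cBV : forall i, agree (pull j (cV i)) (pull (h i) cB).

(** An edge outside the base lies in exactly one copy of [V], and it is given its
    colour there. *)
Definition attach_colouring : colouring attach := fun a b =>
  match a, b with
  | inl x, inl y => cB x y
  | _, _ => if [pick u : I * (V * V) |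
                  (attach_in u.1 u.2.1 == a) && (attach_in u.1 u.2.2 == b)]
              is Some u then cV u.1 u.2.1 u.2.2 else colour0
  end.

Lemma attach_colouringE i (x y : V) : adj x y ->
  attach_colouring (attach_in i x) (attach_in i y) = cV i x y.
Proof.
move=> xy.
have pk (a b : attach_vertex) : attach_in i x = a -> attach_in i y = b ->
    (exists u, a = inr u) \/ (exists u, b = inr u) ->
    (if [pick u : I * (V * V) | (attach_in u.1 u.2.1 == a) &&
      (attach_in u.1 u.2.2 == b)] is Some u then cV u.1 u.2.1 u.2.2 else colour0)
    = cV i x y.
  move=> <- <- new; case: pickP; last by move/(_ (i, (x, y))); rewrite !eqxx.
  move=> [i' [x' y']] /= /andP[/eqP ex /eqP ey].
  suff ei : i' = i by subst i'; rewrite (attach_in_inj ex) (attach_in_inj ey).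
  case: new => [[[i1 u] eu]|[[i1 u] eu]].
    have [e1 _] := attach_in_inr eu; rewrite eu in ex.
    by have [e2 _] := attach_in_inr ex; rewrite e1 e2.
  have [e1 _] := attach_in_inr eu; rewrite eu in ey.
  by have [e2 _] := attach_in_inr ey; rewrite e1 e2.
rewrite /attach_colouring.
case ex: (attach_in i x) => [x'|u]; last by apply: pk => //; left; exists u.
case ey: (attach_in i y) => [y'|v]; last by apply: pk => //; right; exists v.
move: ex ey xy; case: attach_inP => // p -> [<-]; case: attach_inP => // p' -> [<-].
by rewrite (proj2 jE) => pp; symmetry; apply: cBV.
Qed.

Lemma attach_colouring_sym a b : attach_colouring a b = attach_colouring b a.
Proof.
have sw (c d : attach_vertex) : (exists u, c = inr u) \/ (exists u, d = inr u) ->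
    (if [pick u : I * (V * V) | (attach_in u.1 u.2.1 == c) &&
      (attach_in u.1 u.2.2 == d)] is Some u then cV u.1 u.2.1 u.2.2 else colour0) =
    (if [pick u : I * (V * V) | (attach_in u.1 u.2.1 == d) &&
      (attach_in u.1 u.2.2 == c)] is Some u then cV u.1 u.2.1 u.2.2 else colour0).
  move=> new; case: pickP => [[i [x y]] /= /andP[/eqP ex /eqP ey]|no]; last first.
    by case: pickP => // [[i [x y]]] /= xy; have := no (i, (y, x)); rewrite /= andbC xy.
  case: pickP => [[i' [y' x']] /= /andP[/eqP ey' /eqP ex']|/(_ (i, (y, x)))]; last first.
    by rewrite /= ex ey !eqxx.
  suff ei : i' = i.
    subst i'; rewrite -ey' in ey; rewrite -ex' in ex.
    by rewrite (attach_in_inj ex) (attach_in_inj ey) (proj1 (gV i)).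
  case: new => [[[i1 u] eu]|[[i1 u] eu]].
    rewrite eu in ex ex'; have [-> _] := attach_in_inr ex.
    by have [-> _] := attach_in_inr ex'.
  rewrite eu in ey ey'; have [-> _] := attach_in_inr ey.
  by have [-> _] := attach_in_inr ey'.
move: a b => [x|u] [y|v] /=; first exact: (proj1 gB).
all: apply: sw; by [left; eexists | right; eexists].
Qed.

(** No clique straddles two copies: if it has a vertex outside the base, it lies
    in the copy of that vertex, which contains all its neighbours. *)
Lemma attach_good : good attach_colouring.
Proof.
split=> [|a A mA]; first exact: attach_colouring_sym.
have [lt1|] := ltnP 1 #|A|; last by move/leq_ltn_trans; apply; apply: ltnW.
have [[[i x] uA]|noinr] := classic (exists u, (inr u : attach) \in A); last first.
  have -> : A = inl @: (inl @^-1: A : {set B}).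
    apply/setP=> -[b|u]; first by rewrite mem_imset ?inE // => ? ? [].
    have -> : (inr u \in A) = false by apply/negP => uA; apply: noinr; exists u.
    by symmetry; apply/negP => /imsetP[].
  rewrite card_imset; last by move=> ? ? [].
  apply: (proj2 gB a) => b b'; rewrite !inE => bA b'A nb.
  by apply: (mA (inl b) (inl b')) => //; apply: contraNneq nb => -[->].
have inA b : b \in A -> exists y, b = attach_in i y.
  move=> bA; have [->|nb] := eqVneq b (inr (i, x)); last first.
    have [] := mA (inr (i, x)) b; rewrite 1?eq_sym //.
    by case/attach_adj_inr=> y -> _; exists y.
  have [b1 b1A nb1] : exists2 b1, b1 \in A & inr (i, x) != b1.
    have [b1 [b2 [b1A b2A nb12]]] := card_gt1P lt1.
    have [e1|] := eqVneq (inr (i, x) : attach) b1; last by exists b1.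
    by exists b2 => //; rewrite e1.
  have [] := mA (inr (i, x)) b1 uA b1A nb1.
  by case/attach_adj_inr=> y _ [<- _]; exists x.
have -> : A = attach_in i @: [set x | attach_in i x \in A].
  apply/setP=> b; apply/idP/imsetP => [bA|[y]]; last by rewrite inE => yA ->.
  by have [y ey] := inA b bA; exists y => //; rewrite inE -ey.
rewrite card_imset; last exact: attach_in_inj.
apply: (proj2 (gV i) a) => y y'; rewrite !inE => yA y'A ny.
have ny' : attach_in i y != attach_in i y' by apply: contraNneq ny => /attach_in_inj->.
have [yy' cyy'] := mA _ _ yA y'A ny'.
rewrite (proj2 (attach_in_embedding i)) in yy'; split=> //.
by rewrite -cyy' attach_colouringE.
Qed.

End Attach.

(** * Constraints on colourings that can be enforced by a larger graph *)

(** The condition [P] is stated for every [d] which agrees with the restriction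
    of [c] on the edges, which makes [P] depend on the colours of edges only. *)
Definition enforceable (B : sgraph) (P : colouring B -> Prop) : Prop :=
  exists (V : sgraph) (j : B -> V),
  [/\ embedding j,
      forall c d, good c -> agree (pull j c) d -> P d
    & forall d, good d -> P d -> exists2 c, good c & agree (pull j c) d].

Lemma agree_sym (G : sgraph) (c d : colouring G) : agree c d -> agree d c.
Proof. by move=> cd x y xy; rewrite cd. Qed.

Lemma agree_trans (G : sgraph) (c d e : colouring G) :
  agree c d -> agree d e -> agree c e.
Proof. by move=> cd de x y xy; rewrite cd ?de. Qed.

Lemma agree_pull (G H : sgraph) (h : G -> H) (c d : colouring H) :
  embedding h -> agree c d -> agree (pull h c) (pull h d).
Proof. by move=> [_ hh] cd x y xy; apply: cd; rewrite hh. Qed.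

Lemma enforceable_agree (B : sgraph) (P : colouring B -> Prop) d d' :
  enforceable P -> good d -> agree d d' -> P d -> P d'.
Proof.
move=> [V [j [_ Ps Pc]]] gd dd' Pd; have [c gc cd] := Pc d gd Pd.
by apply: (Ps c) => //; apply: agree_trans dd'.
Qed.

Lemma enforceable_iff (B : sgraph) (P Q : colouring B -> Prop) :
  (forall d, P d <-> Q d) -> enforceable P -> enforceable Q.
Proof.
move=> PQ [V [j [jE Ps Pc]]]; exists V, j; split=> // [c d gc cd|d gd /PQ].
  by apply/PQ; apply: (Ps c).
exact: Pc.
Qed.

Lemma enforceable_true (B : sgraph) : enforceable (fun _ : colouring B => True).
Proof. by exists B, id; split=> //; [split|move=> d gd _; exists d]. Qed.

Lemma enforceable_attach (B D : sgraph) (I : finType) (h : I -> D -> B) P :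
  (forall i, embedding (h i)) -> enforceable P ->
  enforceable (fun d : colouring B => forall i, P (pull (h i) d)).
Proof.
move=> hE [V [j [jE Ps Pc]]].
exists (attach j hE), inl; split=> [|c d gc cd i|d gd Pd].
- exact: inl_embedding.
- have gi := good_pull_emb (attach_in_embedding jE hE i) gc.
  apply: (Ps _ _ gi) => x y xy.
  rewrite /pull !(attach_in_port h jE); apply: cd.
  by rewrite (proj2 (hE i)).
have [cV cVP] : exists cV : I -> colouring V, forall i,
    good (cV i) /\ agree (pull j (cV i)) (pull (h i) d).
  apply: (@fin_all_exists I (fun=> colouring V)
    (fun i c => good c /\ agree (pull j c) (pull (h i) d))) => i.
  by have [c] := Pc _ (good_pull_emb (hE i) gd) (Pd i); exists c.
exists (attach_colouring (j := j) (hE := hE) d cV) => //.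
by apply: (attach_good jE hE gd) => i; case: (cVP i).
Qed.

(** Auxiliary vertices: a condition on [B] may be expressed with the help of a
    larger graph [B2] on which it is easier to enforce. *)
Lemma enforceable_project (B B2 : sgraph) (e : B -> B2) P2 (P : colouring B -> Prop) :
  embedding e -> enforceable P2 ->
  (forall d2 d, good d2 -> P2 d2 -> agree (pull e d2) d -> P d) ->
  (forall d, good d -> P d ->
     exists d2, [/\ good d2, P2 d2 & agree (pull e d2) d]) ->
  enforceable P.
Proof.
move=> eE [V [j [jE Ps Pc]]] P2P PP2; exists V, (j \o e); split.
- split; first exact: inj_comp (proj1 jE) (proj1 eE).
  by move=> x y /=; rewrite (proj2 jE) (proj2 eE).
- move=> c d gc cd; apply: (P2P (pull j c)) => //; first exact: good_pull_emb.
  exact: (Ps c).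
move=> d gd /(PP2 d gd)[d2 [gd2 Pd2 d2d]]; have [c gc cd2] := Pc d2 gd2 Pd2.
exists c => //; apply: agree_trans d2d; exact: (agree_pull eE cd2).
Qed.

Lemma enforceable_and (B : sgraph) (P Q : colouring B -> Prop) :
  enforceable P -> enforceable Q -> enforceable (fun d => P d /\ Q d).
Proof.
move=> enfP enfQ; have [V [j [jE Ps Pc]]] := enfP.
have enfQV := @enforceable_attach V B unit (fun=> j) Q (fun=> jE) enfQ.
apply: (enforceable_project jE enfQV) => [d2 d gd2 Qd2 d2d|d gd [Pd Qd]].
  split; first exact: (Ps d2).
  apply: (enforceable_agree enfQ _ d2d (Qd2 tt)); exact: good_pull_emb.
have [c gc cd] := Pc d gd Pd; exists c; split=> // _.
exact: (enforceable_agree enfQ gd (agree_sym cd)).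
Qed.

Lemma enforceable_all (B : sgraph) (K : eqType) (ks : seq K)
    (P : K -> colouring B -> Prop) :
  (forall k, k \in ks -> enforceable (P k)) ->
  enforceable (fun d => forall k, k \in ks -> P k d).
Proof.
elim: ks => [|k ks IH] enfP.
  by apply: enforceable_iff (enforceable_true B) => d; split.
have enfPs : enforceable (fun d => forall k', k' \in ks -> P k' d).
  by apply: IH => k' k'ks; apply: enfP; rewrite inE k'ks orbT.
apply: enforceable_iff (enforceable_and (enfP k (mem_head k ks)) enfPs) => d.
split=> [[Pk Pks] k'|Pks].
  by rewrite inE => /predU1P[->//|]; exact: Pks.
by split=> [|k' k'ks]; apply: Pks; rewrite inE ?eqxx ?k'ks ?orbT.
Qed.

(** * Stars *)

Section Star.
Variable L : finType.

Definition star_adj (x y : option L) : bool := isSome x != isSome y.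

Lemma star_adj_sym : symmetric star_adj.
Proof. by move=> x y; rewrite /star_adj eq_sym. Qed.

Lemma star_adj_irr : irreflexive star_adj.
Proof. by move=> x; rewrite /star_adj eqxx. Qed.

Definition star : sgraph := SGraph star_adj_sym star_adj_irr.

Definition star_colouring (f : L -> 'I_q) : colouring star := fun x y =>
  match x, y with
  | None, Some l | Some l, None => f l
  | _, _ => colour0
  end.

Lemma star_good f : good (star_colouring f).
Proof.
apply: triangle_free_good => [[x|] [y|] //|x y z].
by rewrite /= /star_adj; case: x y z => [?|] [?|] [?|].
Qed.

End Star.

Lemma star_embedding (L L' : finType) (f : L -> L') :
  injective f -> embedding (omap f : star L -> star L').
Proof. by move=> fI; split=> [[x|] [y|] //= [/fI->]//|[x|] [y|]]. Qed.


(** * Cliques *)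

Section Clique.
Variable T : finType.

Definition clique_adj (x y : T) : bool := x != y.

Lemma clique_adj_sym : symmetric clique_adj.
Proof. by move=> x y; rewrite /clique_adj eq_sym. Qed.

Lemma clique_adj_irr : irreflexive clique_adj.
Proof. by move=> x; rewrite /clique_adj eqxx. Qed.

Definition clique : sgraph := SGraph clique_adj_sym clique_adj_irr.

End Clique.

Lemma colourable_clique_le (T U : finType) :
  #|T| <= #|U| -> colourable (clique U) -> colourable (clique T).
Proof.
rewrite -[#|U|]cardsT => /injection_into[f fI _] [c gc].
exists (pull (f : clique T -> clique U) c); apply: good_pull => // x y /=.
by rewrite /clique_adj; apply: contraNneq => /fI->.
Qed.

(** Ramsey's theorem, via sequences in which the colour of a pair depends only
    on its first element. *)
Lemma left_determined m : exists N, forall (T : finType) (c : T -> T -> 'I_q) (A : {set T}),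
  N <= #|A| -> exists (x : nat -> T) (k : nat -> 'I_q), forall i, i < m ->
    x i \in A /\ forall j, i < j < m -> x i != x j /\ c (x i) (x j) = k i.
Proof.
elim: m => [|m [N IH]].
  exists 1 => T c A; rewrite card_gt0 => /set0Pn[x _].
  by exists (fun=> x), (fun=> colour0).
exists (q * N).+2 => T c A leA.
have [x xA] : exists x, x \in A by apply/set0Pn; rewrite -card_gt0; apply: leq_trans leA.
pose B := A :\ x; pose S : finType := {y : T | y \in B}.
have cardS : #|'I_q| * N < #|S|.
  by rewrite card_ord card_sig; move: leA; rewrite (cardsD1 x) xA.
have [a lta] := @pigeonhole S 'I_q (fun y => c x (val y)) N cardS.
have [|y [k yk]] := IH T c (val @: [set y : S | c x (val y) == a]).
  by rewrite card_imset; [exact: ltnW | exact: val_inj].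
have yP i : i < m -> [/\ y i \in A, y i != x & c x (y i) = a].
  move=> /yk[/imsetP[u]]; rewrite inE => /eqP cu -> _.
  by have := valP u; rewrite !inE => /andP[-> ->].
exists (fun i => if i is i'.+1 then y i' else x), (fun i => if i is i'.+1 then k i' else a).
case=> [|i] ltim; split=> //.
- by case=> // j' /= ltj; have [_ ne cy] := yP j' ltj; rewrite eq_sym.
- by have [] := yP i ltim.
by case=> // j' /= ltj; apply: (proj2 (yk i ltim)).
Qed.

Lemma ramsey_clique : exists n, ~ colourable (clique 'I_n).
Proof.
have [N HN] := left_determined (q * t).+1; exists N => -[c [cS cA]].
have [|x [k xk]] := HN _ c [set: 'I_N]; first by rewrite cardsT card_ord.
have [|a lta] := @pigeonhole 'I_(q * t).+1 'I_q (fun i => k i) t.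
  by rewrite !card_ord.
have xI : injective (fun i : 'I_(q * t).+1 => x i).
  move=> i i' eqx; apply: val_inj; have [lti|lti|//] := ltngtP i i'.
    by have [] := proj2 (xk i (ltn_ord i)) i'; rewrite ?lti ?ltn_ord // eqx eqxx.
  by have [] := proj2 (xk i' (ltn_ord i')) i; rewrite ?lti ?ltn_ord // eqx eqxx.
have := cA a ((fun i : 'I_(q * t).+1 => x i) @: [set i : 'I_(q * t).+1 | k i == a]).
rewrite card_imset // ltnNge (ltnW lta) => /(_ _)/negP; apply=> //.
move=> _ _ /imsetP[i ia ->] /imsetP[i' i'a ->] ne; split=> //.
rewrite !inE in ia i'a.
have [lti|lti|eqi] := ltngtP i i'.
- by rewrite (proj2 (proj2 (xk i (ltn_ord i)) i' _)) ?lti ?ltn_ord //; apply/eqP.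
- by rewrite cS (proj2 (proj2 (xk i' (ltn_ord i')) i _)) ?lti ?ltn_ord //; apply/eqP.
by rewrite eqi eqxx in ne.
Qed.

(** The empty set and a single vertex have fewer than [t] vertices, hence the
    largest complete graph with a good colouring is not empty. *)
Lemma largest_clique :
  exists n, colourable (clique 'I_n.+1) /\ ~ colourable (clique 'I_n.+2).
Proof.
have [N] := ramsey_clique; elim: N => [|N IH] nN.
  case: nN; exists (fun _ _ => colour0); split=> // a A _.
  by apply: leq_ltn_trans (max_card _) _; rewrite card_ord; lia.
have [|/IH//] := classic (colourable (clique 'I_N)).
case: N nN {IH} => [|n] nN cN; last by exists n.
case: nN; exists (fun _ _ => colour0); split=> // a A _.
by apply: leq_ltn_trans (max_card _) _; rewrite card_ord; lia.
Qed.

(** A monochromatic star could be duplicated: the twin of its centre, joined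
    to the centre by an edge of another colour, enlarges the clique. *)
Lemma mono_star_extends (T : finType) (c : colouring (clique T)) z a :
  good c -> (forall x, x != z -> c z x = a) -> colourable (clique (option T)).
Proof.
move=> [cS cA] cz.
have [b nab] : exists b : 'I_q, b != a.
  have [a0|na] := eqVneq a colour0; last by exists colour0; rewrite eq_sym.
  by exists (Ordinal q_gt1); rewrite a0.
pose d (x : T) := if x == z then b else a.
exists (fun x y => match x, y with
  | Some x, Some y => c x y | None, Some y => d y | Some x, None => d x
  | None, None => a end); split=> [[x|] [y|]//|e A mA].
have [lt2|] := ltnP 2 #|A|; last by move/leq_ltn_trans; apply.
have sz : (None \notin A) || (Some z \notin A).
  rewrite -negb_and; apply/negP => /andP[nA zA].
  have [x xA /andP[xn xz]] : exists2 x, x \in A & (x != None) && (x != Some z).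
    apply: NNPP => no; suff : #|A| <= #|[set None; Some z]|.
      by rewrite cards2 leqNgt lt2.
    apply: subset_leq_card; apply/subsetP => x xA; rewrite !inE.
    by apply/negP => xx; apply: no; exists x => //; rewrite -negb_or; apply/negP.
  case: x xA xn xz => // x xA _ xz.
  have [_ /=] := mA _ _ nA zA isT; rewrite /d eqxx => be.
  have [_ /=] := mA None (Some x) nA xA isT; rewrite /d.
  by case: eqP => [ex|_ ae]; [rewrite ex eqxx in xz | rewrite be ae eqxx in nab].
(* Replacing the twin by [z] turns a large clique of [A] into one of [c]. *)
pose f (x : option T) := odflt z x.
have fI : {in A &, injective f}.
  move=> [x|] [y|] //= xA yA; rewrite /f /=; first by move->.
    by move=> ex; subst; rewrite xA yA in sz.
  by move=> ex; subst; rewrite xA yA in sz.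
rewrite -(card_in_imset fI); apply: (cA e) => _ _ /imsetP[x xA ->] /imsetP[y yA ->] ne.
split=> //; have nxy : x != y by apply: contraNneq ne => ->.
have [_] := mA x y xA yA nxy.
case: x y xA yA ne nxy => [x|] [y|] //= xA yA ne _; rewrite /f /= in ne *.
  by rewrite /d (negPf ne) cS cz.
by rewrite /d eq_sym (negPf ne) cz 1?eq_sym.
Qed.


(** * A star that is never monochromatic *)

(** The neighbours of [z] are divided into parts, the first [n] of which are
    independent sets, and in no good colouring each of these parts is joined to
    [z] by edges of a single colour (which may depend on the part).  Removing the
    parts one at a time ends with a single never monochromatic part. *)
Definition partite_obstruction (n : nat) := exists (X : sgraph) (z : X) (p : X -> nat),
  [/\ colourable X,
      forall x y, adj z x -> adj z y -> p x = p y -> p x < n -> ~~ adj x y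
    & ~ exists2 c : colouring X, good c & forall i, i < n ->
          exists a, forall x, adj z x -> p x = i -> c z x = a].

(** Take [N] parts and, for each choice of distinct parts for the vertices of the
    largest colourable complete graph, a copy of it, all copies sharing the vertex
    [z].  If each part is joined to [z] in one colour, then many parts share their
    colour, and the copy in these parts has a monochromatic star at [z]. *)
Lemma partite_obstruction_exists : exists n, partite_obstruction n.
Proof.
have [n [[c gc] nc]] := largest_clique.
pose N := (q * n.+1).+1; exists N.
pose I : finType := {f : {ffun 'I_n.+1 -> 'I_N} | injectiveb f}.
pose j (_ : star void) : clique 'I_n.+1 := ord0.
have jE : embedding j by split=> [[]|] [] // [].
have idE : forall i : I, embedding (id : star void -> star void) by split.
pose X := attach j idE.
have attE (f : I) (x : clique 'I_n.+1) : x != ord0 ->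
    attach_in j (fun=> id) f x = inr (f, x).
  by case: attach_inP => // p' ->; rewrite /j eqxx.
have att0 (f : I) : attach_in j (fun=> id) f ord0 = inl None.
  exact: (attach_in_port (fun=> id) jE f None).
pose part (x : X) : nat := if x is inr (f, v) then val f v else 0.
exists X, (inl None), part; split.
- exists (attach_colouring (j := j) (hE := idE) (star_colouring (fun=> colour0)) (fun=> c)).
  by apply: (attach_good jE) => // [|i [[]|] [[]|]]; first exact: star_good.
- move=> [[[]|]|[f v]] [[[]|]|[f' v']] // _ _ epart _.
  apply/negP => /attach_adj_inr[y ey [ex vy]].
  have [e1 e2] := attach_in_inr (esym ey); subst f' y.
  by have /injectiveP := valP f; move/(_ v v' (val_inj epart)) => ev; rewrite ev adj_irr in vy.
move=> [d gd dp].
have [k kP] : exists k : 'I_N -> 'I_q, forall (i : 'I_N) (x : X),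
    adj (inl None : X) x -> part x = i -> d (inl None) x = k i.
  by apply: (@fin_all_exists _ (fun=> 'I_q) (fun (i : 'I_N) a => forall x : X,
    adj (inl None : X) x -> part x = i -> d (inl None) x = a)) => i; apply: dp; apply: ltn_ord.
have [|a lta] := @pigeonhole 'I_N 'I_q k n.+1; first by rewrite !card_ord.
have [|f fI fa] := @injection_into 'I_n.+1 _ [set i | k i == a].
  by rewrite card_ord ltnW.
have injf : injectiveb [ffun v => f v] by apply/injectiveP => x y; rewrite !ffunE => /fI.
pose F : I := exist _ [ffun v => f v] injf.
have gF := good_pull_emb (attach_in_embedding jE idE F) gd.
apply: nc; apply: (@colourable_clique_le _ (option 'I_n.+1)).
  by rewrite card_option !card_ord.
apply: (@mono_star_extends _ _ ord0 a gF) => x nx.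
rewrite /pull att0 attE // (kP (f x)).
- by have := fa x; rewrite inE => /eqP.
- by rewrite -(att0 F) -attE // (proj2 (attach_in_embedding jE idE F)) /adj /= /clique_adj eq_sym.
by rewrite /part /= ffunE.
Qed.

Definition never_mono_star := exists (L : finType) (X : sgraph) (j : star L -> X),
  [/\ embedding j, colourable X
    & forall c, good c -> forall a, exists l, c (j None) (j (Some l)) != a].

(** If the last part can be monochromatic, glue copies of [X] onto a large star
    along all injections of the last part into its leaves.  The large star has
    many leaves of one colour, hence in each good colouring some copy has a
    monochromatic last part; the earlier parts of the copies, taken together,
    are still independent. *)
Lemma partite_obstruction_step n :
  partite_obstruction n.+1 -> never_mono_star \/ partite_obstruction n.
Proof.
move=> [X [z [p [cX indep nomono]]]].
pose L : finType := {x : X | adj z x && (p x == n)}.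
pose j (o : star L) : X := if o is Some l then val l else z.
have LP (l : L) : adj z (val l) /\ p (val l) = n by case/andP: (valP l) => ? /eqP.
have jE : embedding j.
  split=> [[x|] [y|] //= e|[x|] [y|] /=].
  - by congr Some; apply: val_inj.
  - by have [] := LP x; rewrite [val x]e adj_irr.
  - by have [] := LP y; rewrite -[val y]e adj_irr.
  - have [zx px] := LP x; have [zy py] := LP y.
    by rewrite (negbTE (indep _ _ zx zy _ _)) ?px ?py.
  - by rewrite adj_sym; case: (LP x).
  - by case: (LP y).
  by rewrite adj_irr.
have [never|] := classic (forall c : colouring X, good c -> forall a,
    exists l, c (j None) (j (Some l)) != a).
  by left; exists L, X, j.
move=> nnever; right.
have [c0 [gc0 [a0 mono0]]] : exists c0 : colouring X, good c0 /\
    exists a, ~ exists l, c0 (j None) (j (Some l)) != a.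
  apply: NNPP => no; apply: nnever => c gc a; apply: NNPP => nol.
  by apply: no; exists c; split=> //; exists a.
have c0E (l : L) : c0 z (val l) = a0.
  by apply/eqP/negPn/negP => ne; apply: mono0; exists l.
pose Y : finType := 'I_(q * #|L|).+1.
pose I : finType := {f : {ffun L -> Y} | injectiveb f}.
pose h (f : I) : star L -> star Y := omap (val f).
have hE f : embedding (h f) by apply: star_embedding; apply/injectiveP; exact: (valP f).
pose X' := attach j hE.
have att0 f : attach_in j h f z = inl None by apply: (attach_in_port h jE f None).
have attS f (l : L) : attach_in j h f (val l) = inl (Some (val f l)).
  exact: (attach_in_port h jE f (Some l)).
pose part (x : X') : nat := if x is inr (f, v) then p v else n.
have newE f x : adj z x -> p x <> n -> attach_in j h f x = inr (f, x).
  case: attach_inP => // -[l|] ->; first by have [] := LP l.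
  by rewrite /= adj_irr.
have oldE f x : @adj X' (inl None) (inr (f, x)) -> adj z x.
  rewrite adj_sym => /attach_adj_inr[y ey [_ xy]].
  by move: ey; rewrite -(att0 f) => /(attach_in_inj hE)->; rewrite adj_sym.
exists X', (inl None), part; split.
- exists (attach_colouring (j := j) (hE := hE) (star_colouring (fun=> a0)) (fun=> c0)).
  apply: (attach_good jE hE (star_good _)) => // f [x|] [y|] //= _; rewrite /pull /=.
    by rewrite (proj1 gc0) c0E.
  by rewrite c0E.
- have new b : part b < n -> exists f v, b = inr (f, v).
    by case: b => [b|[f v]] /=; [rewrite ltnn | exists f, v].
  move=> a a' za za' epart ltn; have [f [v ea]] := new a ltn.
  have [|f' [v' ea']] := new a'; first by rewrite -epart.
  rewrite {}ea {}ea' /= in za za' epart ltn *.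
  apply/negP => /(@attach_adj_inr _ _ _ _ j h hE)[y ey [ex vy]].
  have [e1 e2] := attach_in_inr (esym ey); subst f' y.
  have /negP := indep v v' (oldE _ _ za) (oldE _ _ za') epart (ltnW ltn).
  exact.
move=> [d gd dp].
have [|a lta] := @pigeonhole Y 'I_q (fun y => d (inl None) (inl (Some y))) #|L|.
  by rewrite !card_ord.
have [f fI fa] := injection_into (ltnW lta).
have injf : injectiveb [ffun l => f l] by apply/injectiveP => x y; rewrite !ffunE => /fI.
pose F : I := exist _ [ffun l => f l] injf.
apply: nomono; exists (pull (attach_in j h F : X -> X') d).
  exact: good_pull_emb (attach_in_embedding jE hE F) gd.
move=> i; rewrite ltnS leq_eqVlt => /predU1P[->|ltin].
  exists a => x zx px; have Lx : adj z x && (p x == n) by rewrite zx px eqxx.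
  rewrite /pull att0 -[x]/(val (exist _ x Lx : L)) attS /= ffunE.
  by have := fa (exist _ x Lx); rewrite inE => /eqP.
have [b db] := dp i ltin; exists b => x zx px.
have npx : p x <> n by move=> e; rewrite -px e ltnn in ltin.
rewrite /pull att0 newE //; apply: db => //.
by rewrite -(att0 F) -newE // (proj2 (attach_in_embedding jE hE F)).
Qed.

Lemma never_mono_star_exists : never_mono_star.
Proof.
have [n sn] := partite_obstruction_exists.
elim: n sn => [[X [z [p [[c gc] _ []]]]]|n IH /partite_obstruction_step[//|/IH//]].
by exists c.
Qed.


(** * Two edges of an induced path *)

(** [Rel] is the set of colourings of the leaves of a star which extend to the
    graph glued onto it; the sequences [us] list the copies of that graph on
    a star with leaf set [M]. *)
Section SplitConstraint.
Variables (L : finType) (Rel : (L -> 'I_q) -> Prop).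
Hypothesis Rel_ext : forall f g, f =1 g -> Rel f -> Rel g.
Hypothesis Rel_sat : exists f, Rel f.
Hypothesis Rel_not_const : forall f a, Rel f -> exists l, f l != a.

Definition satisfies (M : finType) (us : seq {ffun L -> M}) (f : M -> 'I_q) :=
  forall u, u \in us -> Rel (fun l => f (u l)).

(** All injective copies on enough leaves cannot be satisfied together, by the
    pigeonhole principle.  In a critical subfamily, the leaves of one
    copy are replaced by private new leaves one at a time; after the replacement
    that restores satisfiability, the replaced leaf and its replacement cannot
    have the same colour. *)
Lemma split_constraint : exists (M : finType) (us : seq {ffun L -> M}) (x y : M),
  [/\ forall u, u \in us -> injective u, x != y,
      exists f, satisfies us f & forall f, satisfies us f -> f x <> f y].
Proof.
pose Y : finType := 'I_(q * #|L|).+1.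
pose us0 : seq {ffun L -> Y} :=
  filter (fun u : {ffun L -> Y} => injectiveb u) (enum {: {ffun L -> Y}}).
have [|us0u|s1 [k [us [eus [f0 f0P] nsat]]]] :=
    @critical_suffix _ (fun us => exists f, @satisfies Y us f) us0.
- by exists (fun=> colour0).
- case: us0u => f fP.
  have [|a lta] := @pigeonhole Y 'I_q f #|L|; first by rewrite !card_ord.
  have [u uI ua] := injection_into (ltnW lta).
  have [|l] := @Rel_not_const (fun l => f ([ffun l => u l] l)) a.
    apply: fP; rewrite mem_filter mem_enum andbT; apply/injectiveP => v w.
    by rewrite !ffunE => /uI.
  by rewrite ffunE; have := ua l; rewrite inE => ->.
have usI u : u \in k :: us -> injective u.
  move=> uin; apply/injectiveP; suff : u \in us0 by rewrite mem_filter => /andP[].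
  by rewrite eus mem_cat uin orbT.
pose old (u : {ffun L -> Y}) : {ffun L -> Y + L} := [ffun l => inl (u l)].
pose new (s : seq L) : {ffun L -> Y + L} :=
  [ffun l => if l \in s then inr l else inl (k l)].
pose inst s := new s :: map old us.
have [||t1 [x [s [_ nsats /NNPP[f fP]]]]] :=
    @critical_suffix _ (fun s => ~ exists f, satisfies (inst s) f) (enum L).
- case=> f fP; apply: nsat; exists (fun y => f (inl y)) => u; rewrite inE => /predU1P[->|uus].
    by apply: Rel_ext (fP (new [::]) (mem_head _ _)) => l; rewrite ffunE.
  apply: Rel_ext (fP (old u) _) => [l|]; first by rewrite ffunE.
  by rewrite inE map_f ?orbT.
- move=> nsat1; have [f1 Rf1] := Rel_sat; apply: nsat1.
  exists (fun m => match m with inl y => f0 y | inr l => f1 l end) => u.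
  rewrite inE => /predU1P[->|/mapP[v vus ->]].
    by apply: Rel_ext Rf1 => l; rewrite ffunE mem_enum.
  by apply: Rel_ext (f0P v vus) => l; rewrite ffunE.
exists (Y + L)%type, (inst (x :: s)), (inl (k x)), (inr x); split=> //.
- move=> u; rewrite inE => /predU1P[->|/mapP[v vus ->]] l l'; rewrite !ffunE.
    by case: ifP => _; case: ifP => _ // [] //; apply: (usI k (mem_head _ _)).
  by case; apply: (usI v); rewrite inE vus orbT.
- by exists f.
move=> g gP gxy; apply: nsats; exists g => u; rewrite inE => /predU1P[->|uus].
  apply: Rel_ext (gP _ (mem_head _ _)) => l; rewrite !ffunE inE.
  by case: eqP => [->|_] //=; case: ifP.
by apply: gP; rewrite inE uus orbT.
Qed.

End SplitConstraint.

(** The star with two leaves is the induced path [u - z - w].  All ordered pairs of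
    distinct colours occur on it as soon as one does, by permuting the colours. *)
Lemma enforceable_star_distinct : enforceable
  (fun d : colouring (star bool) => d None (Some true) <> d None (Some false)).
Proof.
have [L [X [j [jE [c0 gc0] never]]]] := never_mono_star_exists.
pose Rel (f : L -> 'I_q) := exists2 c : colouring X, good c &
  forall l, c (j None) (j (Some l)) = f l.
have Rel_ext f g : f =1 g -> Rel f -> Rel g.
  by move=> fg [c gc cf]; exists c => // l; rewrite cf.
have Rel_rec (s : 'I_q -> 'I_q) f : injective s -> Rel f -> Rel (fun l => s (f l)).
  move=> sI [c gc cf]; exists (fun x y => s (c x y)); first exact: good_recolour.
  by move=> l; rewrite cf.
have [||M [us [x [y [usI xy [f0 f0P] usP]]]]] := @split_constraint L Rel Rel_ext.
- by exists (fun l => c0 (j None) (j (Some l))); exists c0.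
- by move=> f a [c gc cf]; have [l cl] := never c gc a; exists l; rewrite -cf.
have enfL : enforceable (fun d : colouring (star L) => Rel (fun l => d None (Some l))).
  exists X, j; split=> // [c d gc cd|d gd [c gc cd]].
    by exists c => // l; apply: (cd None (Some l)).
  exists c => // -[l|] [l'|] //= _; last exact: cd.
  by rewrite (proj1 gd) /pull (proj1 gc); apply: cd.
pose h (u : seq_sub us) : star L -> star M := omap (ssval u).
have hE u : embedding (h u) by apply/star_embedding/usI/ssvalP.
pose e : star bool -> star M := omap (fun b : bool => if b then x else y).
have eE : embedding e.
  by apply: star_embedding => -[] [] // exy; rewrite exy eqxx in xy.
apply: (enforceable_project eE (enforceable_attach hE enfL)).
  move=> d2 d gd2 d2P d2d.
  rewrite -(d2d None (Some true)) // -(d2d None (Some false)) //.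
  apply: (usP (fun m => d2 None (Some m))) => u uus; exact: (d2P (SeqSub uus)).
move=> d gd /eqP dd; have /eqP fxy := usP _ f0P.
have [s [sI sx sy]] := injection_two_points fxy dd.
exists (star_colouring (fun m => s (f0 m))); split; first exact: star_good.
  by move=> u; apply: Rel_rec => //; apply: f0P; apply: ssvalP.
by move=> [[]|] [[]|] //= _; rewrite /pull /= ?sx ?sy // (proj1 gd).
Qed.

(** Besides the two given leaves there are [q - 1] further ones, and all pairs of
    leaves except the given one must get distinct colours.  If the given leaves
    also differed, [q + 1] distinct colours would be needed. *)
Lemma enforceable_star_equal : enforceable
  (fun d : colouring (star bool) => d None (Some true) = d None (Some false)).
Proof.
pose M : finType := (bool + 'I_q.-1)%type.
pose I : finType := {u : M * M | (u.1 != u.2) && ~~ (is_inl u.1 && is_inl u.2)}.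
pose h (u : I) : star bool -> star M :=
  omap (fun b : bool => if b then (val u).1 else (val u).2).
have hE u : embedding (h u).
  have /andP[ne _] := valP u.
  by apply: star_embedding => -[] [] // e; rewrite e eqxx in ne.
pose e : star bool -> star M := omap inl.
have eE : embedding e by apply: star_embedding => x y [].
apply: (enforceable_project eE (enforceable_attach hE enforceable_star_distinct)).
  move=> d2 d gd2 d2P d2d.
  rewrite -(d2d None (Some true)) // -(d2d None (Some false)) // /pull /=.
  apply/eqP/negPn/negP => ne.
  have dI : injective (fun m : M => d2 None (Some m)).
    move=> m m' eqd; apply/eqP/negPn/negP => nm.
    have [/andP[]|nb] := boolP (is_inl m && is_inl m'); last first.
      have um : (m != m') && ~~ (is_inl m && is_inl m') by rewrite nm.
      by have := d2P (exist _ (m, m') um); rewrite /pull /= eqd.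
    by case: m m' nm eqd => [[]|?] [[]|?] //= _ eqd; rewrite eqd eqxx in ne.
  by have := leq_card _ dI; rewrite card_sum card_bool !card_ord; lia.
move=> d gd dd; pose f (m : M) := match m with
  inl _ => d None (Some true) | inr i => lift (d None (Some true)) i end.
exists (star_colouring f); split; first exact: star_good.
  move=> [[m m'] um]; have /andP[/= nm nb] := um; rewrite /pull /= /f.
  case: m m' {um} nm nb => [b|i] [b'|i'] //= nm _.
  - by move=> ell; have := neq_lift (d None (Some true)) i'; rewrite -ell eqxx.
  - by move=> ell; have := neq_lift (d None (Some true)) i; rewrite ell eqxx.
  by move=> ell; have ei := lift_inj ell; rewrite ei eqxx in nm.
by move=> [[]|] [[]|] //= _; rewrite /pull /= ?(proj1 gd (Some _) None) dd.
Qed.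


Lemma enforceable_star_signed (sg : bool) : enforceable
  (fun d : colouring (star bool) => (d None (Some true) == d None (Some false)) = sg).
Proof.
case: sg.
  by apply: enforceable_iff enforceable_star_equal => d; split=> [->|/eqP//]; rewrite eqxx.
by apply: enforceable_iff enforceable_star_distinct => d; split=> [/eqP/negPf//|/negbT/eqP].
Qed.

(** * Two arbitrary edges *)

(** The edges [o s - e s] are joined by a new path through three vertices, from
    [e true] over [Some true], [None], [Some false] to [e false].  Any two
    consecutive edges of the resulting walk from [o true] to [o false] form an
    induced path, even if the given edges share vertices or are close together.
    So equality can be passed along, and the relation wanted is imposed at the
    middle vertex [None]. *)
Section TwoEdges.
Variables (B : sgraph) (o e : bool -> B).
Hypothesis oe : forall s, adj (o s) (e s).

Definition link_vertex : finType := (B + option bool)%type.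

Definition link_adj (u v : link_vertex) : bool :=
  match u, v with
  | inl a, inl b => adj a b
  | inl a, inr (Some s) | inr (Some s), inl a => a == e s
  | inr i, inr j => isSome i != isSome j
  | _, _ => false
  end.

Lemma link_adj_sym : symmetric link_adj.
Proof. by move=> [a|[s|]] [b|[s'|]] //=; exact: adj_sym. Qed.

Lemma link_adj_irr : irreflexive link_adj.
Proof. by move=> [a|[s|]] //=; exact: adj_irr. Qed.

Definition link : sgraph := SGraph link_adj_sym link_adj_irr.

Lemma link_no_new_triangle i (v w : link) :
  adj (inr i : link) v -> adj (inr i : link) w -> adj v w -> False.
Proof.
case: i v w => [s|] [a|[s1|]] [b|[s2|]] //=; move=> /eqP-> /eqP->.
by rewrite adj_irr.
Qed.

Definition link_colouring (d : colouring B) : colouring link := fun u v =>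
  match u, v with
  | inl a, inl b => d a b
  | inl _, inr (Some s) | inr (Some s), inl _
  | inr None, inr (Some s) | inr (Some s), inr None => d (o s) (e s)
  | _, _ => colour0
  end.

Lemma link_good d : good d -> good (link_colouring d).
Proof.
move=> [dS dA]; split=> [[a|[s|]] [b|[s'|]] //=|k A mA].
have [lt2|] := ltnP 2 #|A|; last by move/leq_ltn_trans; apply.
have [[i iA]|noinr] := classic (exists i, (inr i : link) \in A).
  have : 1 < #|A :\ (inr i : link)| by move: lt2; rewrite (cardsD1 (inr i : link)) iA.
  case/card_gt1P=> v [w [/setD1P[vi vA] /setD1P[wi wA] vw]].
  have [iv _] : adj (inr i : link) v /\ _ := mA _ v iA vA (contra_neq esym vi).
  have [iw _] : adj (inr i : link) w /\ _ := mA _ w iA wA (contra_neq esym wi).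
  by have [vw' _] := mA v w vA wA vw; case: (link_no_new_triangle iv iw vw').
have -> : A = inl @: (inl @^-1: A : {set B}).
  apply/setP=> -[b|i]; first by rewrite mem_imset ?inE // => ? ? [].
  have -> : (inr i \in A) = false by apply/negP => iA; apply: noinr; exists i.
  by symmetry; apply/negP => /imsetP[].
rewrite card_imset; last by move=> ? ? [].
apply: (dA k) => b b'; rewrite !inE => bA b'A nb.
by apply: (mA (inl b) (inl b')) => //; apply: contraNneq nb => -[->].
Qed.

(** The four induced paths on which equality is imposed: with centre [e s] if
    the first component is [true], and with centre [Some s] otherwise. *)
Definition link_star (i : bool * bool) (l : star bool) : link :=
  match l with
  | None => if i.1 then inl (e i.2) else inr (Some i.2)
  | Some b => if i.1 then (if b then inl (o i.2) else inr (Some i.2))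
              else if b then inl (e i.2) else inr None
  end.

Definition middle_star (l : star bool) : link := inr (omap id l).

Lemma enforceable_two_edges (sg : bool) : enforceable
  (fun d : colouring B => (d (o true) (e true) == d (o false) (e false)) = sg).
Proof.
have oeN s : (o s == e s) = false.
  by apply/negbTE/negP => /eqP E; have := oe s; rewrite E adj_irr.
have eo s : adj (e s) (o s) by rewrite adj_sym.
have starE i : embedding (link_star i).
  case: i => [[] s]; split=> [[[]|] [[]|] //=|[[]|] [[]|]] /=;
    rewrite ?adj_irr ?oe ?eo ?eqxx //; case=> E; by move: (oeN s); rewrite E eqxx.
have middleE : embedding middle_star.
  by split=> [[[]|] [[]|] //|[[]|] [[]|]].
have idE : embedding (inl : B -> link) by split=> // x y [].
pose P2 (d : colouring link) :=
  (forall i, pull (link_star i) d None (Some true) = pull (link_star i) d None (Some false)) /\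
  (forall i : unit,
     (pull middle_star d None (Some true) == pull middle_star d None (Some false)) = sg).
have enfP2 : enforceable P2.
  apply: enforceable_and; first exact: enforceable_attach starE enforceable_star_equal.
  exact: (enforceable_attach (fun=> middleE) (enforceable_star_signed sg)).
have P2E d : good d -> P2 d ->
    (d (inl (o true)) (inl (e true)) == d (inl (o false)) (inl (e false))) = sg.
  move=> [dS _] [eqs /(_ tt) <-]; rewrite /pull /middle_star /=.
  have side s : d (inl (o s)) (inl (e s)) = d (inr None) (inr (Some s)).
    have := eqs (true, s); have := eqs (false, s); rewrite /pull /=.
    by rewrite (dS (inl (e s)) (inl (o s))) (dS (inr (Some s)) (inl (e s)))
      (dS (inr (Some s)) (inr None)) => <- <-.
  by rewrite !side.
apply: (enforceable_project idE enfP2) => [d2 d gd2 Pd2 d2d|d gd Pd].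
  by rewrite -!d2d ?oe // /pull; apply: P2E.
exists (link_colouring d); split; [exact: link_good | | by []].
split=> [[[] s]|_]; rewrite /pull /middle_star //=.
by rewrite (proj1 gd).
Qed.

End TwoEdges.

Definition constraint (G : sgraph) : Type := (G * G) * (G * G) * bool.

Definition constraint_ok (G : sgraph) (k : constraint G) :=
  adj k.1.1.1 k.1.1.2 && adj k.1.2.1 k.1.2.2.

Definition holds (G : sgraph) (d : colouring G) (k : constraint G) : bool :=
  (d k.1.1.1 k.1.1.2 == d k.1.2.1 k.1.2.2) == k.2.

Lemma holds_agree (G : sgraph) (d d' : colouring G) k :
  agree d d' -> constraint_ok k -> holds d k = holds d' k.
Proof. by move=> dd' /andP[k1 k2]; rewrite /holds !dd'. Qed.

Lemma enforceable_holds (G : sgraph) (k : constraint G) :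
  constraint_ok k -> enforceable (fun d => holds d k).
Proof.
case: k => [[[x y] [x' y']] sg] /andP[/= xy xy'].
have oe (s : bool) : adj (if s then x else x') (if s then y else y') by case: s.
have := @enforceable_two_edges G (fun s => if s then x else x')
  (fun s => if s then y else y') oe sg.
by apply: enforceable_iff => d; rewrite /holds /=; split=> [->|/eqP].
Qed.

(** * Disjoint copies *)

(** Disjoint unions are glueings along the empty graph. *)
Lemma disjoint_copies (B V : sgraph) (I : finType) :
  exists (U : sgraph) (b : B -> U) (v : I -> V -> U),
  [/\ embedding b, forall i, embedding (v i)
    & forall (cB : colouring B) (cV : I -> colouring V),
      good cB -> (forall i, good (cV i)) ->
      exists c, [/\ good c, agree (pull b c) cB & forall i, agree (pull (v i) c) (cV i)]].
Proof.
pose nul (G : sgraph) (x : clique void) : G := match x with end.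
have nulE G : embedding (nul G) by split=> [[]|[]].
pose h (i : I) := nul B; have hE i : embedding (h i) := nulE B.
exists (attach (nul V) hE), inl, (attach_in (nul V) h); split.
- exact: inl_embedding.
- by move=> i; apply: (attach_in_embedding (nulE V)).
move=> cB cV gB gV.
have agr i : agree (pull (nul V) (cV i)) (pull (h i) cB) by case.
exists (attach_colouring (j := nul V) (hE := hE) cB cV).
split=> // [|i x y]; first exact: (attach_good (nulE V) hE gB gV agr).
exact: (attach_colouringE (nulE V)).
Qed.

(** * Joining new vertices to given sets *)

(** The vertex [inr i] is joined to the set [S i] if [i] belongs to [J].  The
    vertex type does not depend on [J], so deleting a new vertex amounts to
    removing it from [J] and keeps the colourings comparable. *)
Section Cone.
Variables (W : sgraph) (k : nat) (S : 'I_k -> {set W}).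

Definition cone_vertex : finType := (W + 'I_k)%type.

Section ConeGraph.
Variable J : {set 'I_k}.

Definition cone_adj (u v : cone_vertex) : bool :=
  match u, v with
  | inl a, inl b => adj a b
  | inl a, inr i | inr i, inl a => (i \in J) && (a \in S i)
  | _, _ => false
  end.

Lemma cone_adj_sym : symmetric cone_adj.
Proof. by move=> [a|i] [b|i'] //=; exact: adj_sym. Qed.

Lemma cone_adj_irr : irreflexive cone_adj.
Proof. by move=> [a|i] //=; exact: adj_irr. Qed.

Definition cone : sgraph := SGraph cone_adj_sym cone_adj_irr.

Lemma cone_inl_embedding : embedding (inl : W -> cone).
Proof. by split=> // x y []. Qed.

Definition cone_colouring (c : colouring W) (f : 'I_k -> W -> 'I_q) : colouring cone :=
  fun u v => match u, v with
  | inl a, inl b => c a b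
  | inl a, inr i | inr i, inl a => f i a
  | _, _ => colour0
  end.

Lemma cone_good c f : good c ->
  (forall i, i \in J -> forall a (K : {set W}), K \subset S i -> mono_clique c a K ->
     {in K, forall x, f i x = a} -> #|K|.+1 < t) ->
  good (cone_colouring c f).
Proof.
move=> [cS cA] fP; split=> [[x|i] [y|i'] //=|a A mA].
pose K : {set W} := inl @^-1: A.
have cardK : #|inl @: K : {set cone}| = #|K| by rewrite card_imset // => ? ? [].
have mK : mono_clique c a K.
  move=> x y; rewrite !inE => xA yA nxy.
  have ne : (inl x : cone) != inl y by apply: contraNneq nxy => -[->].
  exact: (mA (inl x) (inl y)).
have [[i iA]|noinr] := classic (exists i, (inr i : cone) \in A); last first.
  suff -> : A = inl @: K by rewrite cardK; apply: cA mK.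
  apply/setP=> -[x|i]; first by rewrite mem_imset ?inE // => ? ? [].
  have -> : (inr i \in A) = false by apply/negP => iA; apply: noinr; exists i.
  by symmetry; apply/negP => /imsetP[].
have -> : A = (inr i : cone) |: inl @: K.
  apply/setP=> -[x|i']; rewrite !inE /=.
    by rewrite mem_imset ?inE // => ? ? [].
  have -> : (inr i' \in (inl @: K : {set cone})) = false by apply/negP => /imsetP[].
  rewrite orbF; apply/idP/eqP => [i'A|->//]; apply/eqP/negPn/negP => ne.
  by have [] := mA (inr i') (inr i) i'A iA ne.
rewrite cardsU1 cardK (_ : inr i \notin _); last by apply/negP => /imsetP[].
have KP x : x \in K -> (i \in J) && (x \in S i) /\ f i x = a.
  by rewrite inE => xA; have [] := mA (inr i) (inl x) iA xA isT.
have [->|[x0 x0K]] := set_0Vmem K; first by rewrite cards0 /=; apply: ltnW.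
have [/andP[iJ _] _] := KP x0 x0K; rewrite add1n.
apply: (fP i iJ a) => //; last by move=> x /KP[].
by apply/subsetP => x /KP[/andP[]].
Qed.

Lemma cone_extends (c : colouring cone) i : good c -> i \in J ->
  forall a (K : {set W}), K \subset S i -> mono_clique (pull (inl : W -> cone) c) a K ->
    {in K, forall x, c (inr i) (inl x) = a} -> #|K|.+1 < t.
Proof.
move=> [cS cA] iJ a K KS mK Ka.
have cardK : #|inl @: K : {set cone}| = #|K| by rewrite card_imset // => ? ? [].
have ninr : inr i \notin (inl @: K : {set cone}) by apply/negP => /imsetP[].
have <- : #|(inr i : cone) |: inl @: K| = #|K|.+1 by rewrite cardsU1 cardK ninr.
apply: (cA a) => u v; rewrite !inE.
move=> /predU1P[->|/imsetP[x xK ->]] /predU1P[->|/imsetP[y yK ->]] ne.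
- by rewrite eqxx in ne.
- by split; [rewrite /= iJ (subsetP KS) | apply: Ka].
- by split; [rewrite /= iJ (subsetP KS) | rewrite cS; apply: Ka].
by have [|xy cxy] := mK x y xK yK; [apply: contraNneq ne => -> | split].
Qed.

Lemma degree_cone i : i \in J -> degree (inr i : cone) = #|S i|.
Proof.
move=> iJ; rewrite /degree; have inlI : injective (inl : W -> cone_vertex) by move=> ? ? [].
rewrite -(card_imset (S i) inlI); apply: eq_card => -[x|i'].
  by rewrite inE (mem_imset _ _ inlI) /= iJ.
by rewrite inE /=; symmetry; apply/negP => /imsetP[].
Qed.

End ConeGraph.
End Cone.

(** The colours [f] of the edges from a new vertex to all of [A] complete no
    monochromatic clique of size [t]. *)
Definition extendable (A : sgraph) (c : colouring A) := exists f : A -> 'I_q,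
  forall a (K : {set A}), mono_clique c a K -> {in K, forall x, f x = a} -> #|K|.+1 < t.

Lemma extendable_agree (A : sgraph) (c d : colouring A) :
  agree c d -> extendable c -> extendable d.
Proof.
move=> cd [f fP]; exists f => a K mK; apply: fP.
exact: mono_clique_agree (agree_sym cd) mK.
Qed.

Lemma extendable_recolour (A : sgraph) (s : 'I_q -> 'I_q) (c : colouring A) :
  injective s -> extendable c -> extendable (fun x y => s (c x y)).
Proof.
move=> sI [f fP]; have [s' sK s'K] := injF_bij sI.
exists (fun x => s (f x)) => a K mK Ka; apply: (fP (s' a)) => [x y xK yK nxy|x xK].
  by have [xy <-] := mK x y xK yK nxy; rewrite sK.
by rewrite -(Ka x xK) sK.
Qed.

(** * An equality that only the new vertex enforces *)

(** The vertex [v] is essential: deleting it leaves a graph with a good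
    colouring. *)
Definition good_away (W : sgraph) (v : W) (d : colouring W) :=
  (forall x y, d x y = d y x) /\
  forall a (K : {set W}), v \notin K -> mono_clique d a K -> #|K| < t.

Lemma holds_recolour (G : sgraph) (s : 'I_q -> 'I_q) (d : colouring G) k :
  injective s -> holds (fun x y => s (d x y)) k = holds d k.
Proof. by move=> sI; rewrite /holds (inj_eq sI). Qed.

Section Assembly.
Variables (A : sgraph) (c c' : colouring A).
Hypotheses (gc : good c) (nc : ~ extendable c) (gc' : good c') (ec' : extendable c').

(** The palette edges [p b] represent the colours, and the pins forbid an edge of
    [A] to have the colour of [p b] when [b] is not its colour under [c].  With
    all pins the colouring of [A] is [c] up to a permutation of the colours, so it
    is not extendable; without pins [c'] is allowed.  At the critical pin every
    extendable colouring that respects the earlier ones violates it, that is, the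
    two edges have equal colours, whereas [c] itself satisfies all pins. *)
Lemma switch_gadget : exists (C : sgraph) (i : A -> C) (ks : seq (constraint C)) (e f : C * C),
  [/\ embedding i, [/\ {in ks, forall k, constraint_ok k}, adj e.1 e.2 & adj f.1 f.2],
      forall d, good d -> {in ks, forall k, holds d k} -> extendable (pull i d) ->
        d e.1 e.2 = d f.1 f.2,
      exists d, [/\ good d, {in ks, forall k, holds d k} & extendable (pull i d)]
    & exists d, [/\ good d, {in ks, forall k, holds d k} & d e.1 e.2 != d f.1 f.2]].
Proof.
have [C [i [p [iE pE CP]]]] := disjoint_copies A (clique bool) 'I_q.
have pP b : adj (p b true) (p b false) by rewrite (proj2 (pE b)).
have palE b : good (fun _ _ : clique bool => b : 'I_q).
  by split=> // a K _; apply: leq_ltn_trans (max_card _) _; rewrite card_bool.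
pose pal : seq (constraint C) := [seq ((p u.1 true, p u.1 false), (p u.2 true, p u.2 false), false)
  | u <- enum {: 'I_q * 'I_q} & u.1 != u.2].
pose pins : seq (constraint C) := [seq ((i u.1.1, i u.1.2), (p u.2 true, p u.2 false), false)
  | u <- enum {: A * A * 'I_q} & adj u.1.1 u.1.2 && (u.2 != c u.1.1 u.1.2)].
have pal_ok : {in pal, forall k, constraint_ok k}.
  by move=> k /mapP[u _ ->]; rewrite /constraint_ok /= !pP.
have pins_ok : {in pins, forall k, constraint_ok k}.
  move=> k /mapP[u]; rewrite mem_filter => /andP[/andP[xy _] _] ->.
  by rewrite /constraint_ok /= pP (proj2 iE) xy.
have pal_holds d : (forall b, agree (pull (p b) d) (fun _ _ => b)) ->
    {in pal, forall k, holds d k}.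
  move=> dp k /mapP[u]; rewrite mem_filter => /andP[nu _] ->; rewrite /holds /=.
  have dE b : d (p b true) (p b false) = b by apply: (dp b true false).
  by rewrite !dE eqbF_neg.
have [||s1 [k [s [epins [d1 [gd1 pald1 sd1 ed1]] crit]]]] := @critical_suffix _
  (fun s => exists d, [/\ good d, {in pal, forall k, holds d k},
     {in s, forall k, holds d k} & extendable (pull i d)]) pins.
- have [d [gd di dp]] := CP c' (fun b _ _ => b) gc' palE.
  exists d; split=> //; first exact: pal_holds.
  exact: extendable_agree (agree_sym di) ec'.
- case=> d [gd pald pind ed].
  (* The permutation that relates the colouring of the palette to the colours. *)
  pose sg b := d (p b true) (p b false).
  have sgI : injective sg.
    move=> a b esg; apply/eqP/negPn/negP => nab.
    have := pald ((p a true, p a false), (p b true, p b false), false).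
    rewrite /holds /= -/(sg a) -/(sg b) esg eqxx => /(_ _)/negP; apply=> //.
    by apply/mapP; exists (a, b); rewrite // mem_filter nab mem_enum.
  have [sg' sgK sg'K] := injF_bij sgI.
  have dsg : agree (pull i d) (fun x y => sg (c x y)).
    move=> x y xy; rewrite -[LHS]sg'K; congr sg; apply/eqP/negPn/negP => ne.
    have := pind ((i x, i y), (p (sg' (pull i d x y)) true, p (sg' (pull i d x y)) false), false).
    rewrite /holds /= -/(sg _) sg'K eqxx => /(_ _)/negP; apply=> //.
    apply/mapP; exists (x, y, sg' (pull i d x y)) => //.
    by rewrite mem_filter mem_enum /= xy ne.
  apply: nc; apply: (@extendable_agree _ (fun x y => sg' (sg (c x y)))).
    by move=> x y _; rewrite sgK.
  apply: (extendable_recolour (can_inj sg'K)).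
  exact: extendable_agree dsg ed.
have ksub k' : k' \in k :: s -> k' \in pins by rewrite epins mem_cat => ->; rewrite orbT.
have /mapP[u] := ksub k (mem_head _ _).
rewrite mem_filter => /andP[/andP[xy nu] _] ek.
exists C, i, (pal ++ s), (i u.1.1, i u.1.2), (p u.2 true, p u.2 false).
have cat_in (Q : constraint C -> bool) : {in pal, forall k, Q k} -> {in s, forall k, Q k} ->
    {in pal ++ s, forall k, Q k}.
  by move=> Qp Qs k'; rewrite mem_cat => /orP[/Qp|/Qs].
split=> //.
- split=> //=; last by rewrite (proj2 iE).
  by apply: cat_in => // k' k's; apply: pins_ok; apply: ksub; rewrite inE k's orbT.
- move=> d gd dks ed; apply/eqP/negPn/negP => ne; apply: crit; exists d; split=> //.
    by move=> k' k'p; apply: dks; rewrite mem_cat k'p.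
  move=> k'; rewrite inE => /predU1P[->|k's]; last by apply: dks; rewrite mem_cat k's orbT.
  by rewrite ek /holds /= (negPf ne).
- by exists d1; split=> //; apply: cat_in.
have [d0 [gd0 d0i d0p]] := CP c (fun b _ _ => b) gc palE.
have dE b : d0 (p b true) (p b false) = b by apply: (d0p b true false).
have dcE x y : adj x y -> d0 (i x) (i y) = c x y by apply: d0i.
exists d0; split=> //; last by rewrite dE dcE // eq_sym.
apply: cat_in; first exact: pal_holds.
move=> k' k's; have /mapP[v] : k' \in pins by apply: ksub; rewrite inE k's orbT.
rewrite mem_filter => /andP[/andP[vxy nv] _] ->.
by rewrite /holds /= dE dcE // eqbF_neg eq_sym.
Qed.

(** In a chain of [k + 1] switch gadgets the edge [f] of each copy has the colour
    of [e] in the next copy, while [f] of the last copy and [e] of the first copy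
    must differ.  If all new vertices are present, all these colours are equal, a
    contradiction.  Without the new vertex [m0] the colour may change from [al] to
    [be] inside copy [m0], and nowhere else. *)
Lemma many_essential_vertices (k : nat) : exists (W : sgraph) (v : 'I_k.+1 -> W),
  [/\ injective v, ~ colourable W, forall m, degree (v m) = #|A|
    & forall m, exists d, good_away (v m) d].
Proof.
have [C [i [ks [e [f [iE [ksok eok fok] F1 [d1 [gd1 ksd1 ed1]] [d0 [gd0 ksd0 ned0]]]]]]]]
  := switch_gadget.
have [U [b [p [_ pE UP]]]] := disjoint_copies (clique void) C 'I_k.+1.
pose links : seq (constraint U) :=
  [seq ((p u.1 f.1, p u.1 f.2), (p u.2 e.1, p u.2 e.2), true)
     | u : 'I_k.+1 * 'I_k.+1 <- enum {: 'I_k.+1 * 'I_k.+1} & val u.2 == (val u.1).+1].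
pose lastk : constraint U :=
  ((p ord_max f.1, p ord_max f.2), (p ord0 e.1, p ord0 e.2), false).
have links_ok l : l \in links -> constraint_ok l.
  by move=> /mapP[u _ ->]; rewrite /constraint_ok /= !(proj2 (pE _)) eok fok.
have last_ok : constraint_ok lastk by rewrite /constraint_ok /= !(proj2 (pE _)) eok fok.
have enfC : enforceable (fun d : colouring C => forall l, l \in ks -> holds d l).
  by apply: enforceable_all => l /ksok; apply: enforceable_holds.
have enfL : enforceable (fun d : colouring U => forall l, l \in links -> holds d l).
  by apply: enforceable_all => l /links_ok; apply: enforceable_holds.
have [V [j [jE Qs Qc]]] := enforceable_and (enforceable_attach pE enfC)
  (enforceable_and enfL (enforceable_holds last_ok)).
pose emb m (x : A) : V := j (p m (i x)).
have embE m : embedding (emb m).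
  split=> [x y /(proj1 jE)/(proj1 (pE m))/(proj1 iE)//|x y].
  by rewrite (proj2 jE) (proj2 (pE m)) (proj2 iE).
have embI m := proj1 (embE m).
pose S m := emb m @: [set: A].
exists (cone S [set: 'I_k.+1]), inr; split.
- by move=> m m' [].
- case=> cW gW; pose c1 : colouring V := pull (inl : V -> cone S setT) cW.
  have gc1 : good c1 := good_pull_emb (cone_inl_embedding S setT) gW.
  pose D := pull j c1; have gD : good D := good_pull_emb jE gc1.
  have [QC [QL Qlast]] : _ /\ (_ /\ _) := Qs c1 D gc1 (fun _ _ _ => erefl).
  have eqm m : D (p m e.1) (p m e.2) = D (p m f.1) (p m f.2).
    apply: (F1 (pull (p m) D)) => //; first exact: good_pull_emb (pE m) gD.
      exact: QC.
    exists (fun x => cW (inr m) (inl (emb m x))) => a K mK Ka.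
    rewrite -(card_imset K (embI m)); apply: (cone_extends gW (in_setT m) (a := a)).
    + by apply: imsetS; apply: subsetT.
    + by apply: (@mono_clique_image _ _ (emb m) c1 a K) => // x y; rewrite (proj2 (embE m)).
    by move=> _ /imsetP[x xK ->]; apply: Ka.
  have chain n (ltn : n < k.+1) :
      D (p (Ordinal ltn) f.1) (p (Ordinal ltn) f.2) = D (p ord0 e.1) (p ord0 e.2).
    elim: n ltn => [|n IH] ltn; first by rewrite (_ : Ordinal ltn = ord0) -?eqm //; apply: val_inj.
    have ltn' : n < k.+1 := ltnW ltn; rewrite -(IH ltn') -eqm.
    have := QL ((p (Ordinal ltn') f.1, p (Ordinal ltn') f.2),
      (p (Ordinal ltn) e.1, p (Ordinal ltn) e.2), true).
    rewrite /holds /= eqb_id => /(_ _)/eqP->//.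
    by apply/mapP; exists (Ordinal ltn', Ordinal ltn); rewrite // mem_filter mem_enum /= eqxx.
  by move: Qlast; rewrite /holds /= -(chain k (ltnSn k)) (_ : Ordinal _ = ord_max) ?eqxx //;
    apply: val_inj.
- by move=> m; rewrite degree_cone ?inE // card_imset ?cardsT.
move=> m0; pose al := d0 e.1 e.2; pose be := d0 f.1 f.2; pose ga := d1 e.1 e.2.
pose Dm (m : 'I_k.+1) : colouring C := if m < m0 then fun x y => tperm ga al (d1 x y)
  else if m == m0 then d0 else fun x y => tperm ga be (d1 x y).
have gDm m : good (Dm m).
  by rewrite /Dm; case: ifP => _; [|case: ifP => _ //]; apply: good_recolour => //; apply: perm_inj.
have gv : good (fun _ _ : clique void => colour0).
  by split=> // a K _; apply: leq_ltn_trans (max_card _) _; rewrite card_void; lia.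
have [D [gD _ Dag]] := UP _ Dm gv gDm.
have Dme m : D (p m e.1) (p m e.2) = if m <= m0 then al else be.
  rewrite -[LHS]/(pull (p m) D e.1 e.2) Dag // /Dm -val_eqE /=.
  by case: ltngtP => //= _; rewrite /ga ?tpermL.
have Dmf m : D (p m f.1) (p m f.2) = if m < m0 then al else be.
  have d1e : d1 f.1 f.2 = ga by rewrite /ga (F1 d1).
  rewrite -[LHS]/(pull (p m) D f.1 f.2) Dag // /Dm; case: ifP => // _.
    by rewrite d1e tpermL.
  by case: ifP => // _; rewrite d1e tpermL.
have QD : (forall m, forall l, l \in ks -> holds (pull (p m) D) l) /\
    ((forall l, l \in links -> holds D l) /\ holds D lastk).
  split=> [m l lks|]; last split=> [l /mapP[u]|].
  - rewrite (holds_agree (Dag m)) ?ksok // /Dm.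
    by case: ifP => _; [|case: ifP => _; [exact: ksd0|]];
      rewrite holds_recolour ?ksd1 //; apply: perm_inj.
  - rewrite mem_filter => /andP[/eqP eu _] ->; rewrite /holds /= Dmf Dme eu.
    by rewrite eqxx.
  by rewrite /holds /= Dmf Dme leq0n ltnNge -ltnS ltn_ord /= eqbF_neg eq_sym.
have [c0 gc0 c0D] := Qc D gD QD.
have c0A m : agree (pull i (Dm m)) (pull (emb m) c0).
  move=> x y xy; rewrite -[RHS]/(pull j c0 (p m (i x)) (p m (i y))).
  rewrite c0D ?(proj2 (pE m)) ?(proj2 iE) //.
  by symmetry; apply: (Dag m); rewrite (proj2 iE).
have [phi phiP] : exists phi : 'I_k.+1 -> A -> 'I_q, forall m, m != m0 ->
    forall a (K : {set A}), mono_clique (pull (emb m) c0) a K ->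
      {in K, forall x, phi m x = a} -> #|K|.+1 < t.
  apply: (@fin_all_exists _ (fun=> A -> 'I_q) (fun m (g : A -> 'I_q) => m != m0 ->
    forall a (K : {set A}), mono_clique (pull (emb m) c0) a K ->
      {in K, forall x, g x = a} -> #|K|.+1 < t)) => m.
  have [->|nm] := eqVneq m m0; first by exists (fun=> colour0).
  have [g gP] : extendable (pull (emb m) c0).
    apply: extendable_agree (c0A m) _; rewrite /Dm (negPf nm).
    by case: ifP => _; apply: (extendable_recolour (perm_inj (s := _))).
  by exists g.
pose g m (w : V) := if [pick x | emb m x == w] is Some x then phi m x else colour0.
have gE m x : g m (emb m x) = phi m x.
  rewrite /g; case: pickP => [x' /eqP/embI->//|/(_ x)]; by rewrite eqxx.
have [dS dA] : good (cone_colouring (S := S) (J := [set~ m0]) c0 g).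
  apply: cone_good => // m; rewrite !inE => nm a K KS mK Ka.
  have EK : K = emb m @: (emb m @^-1: K).
    apply/setP=> w; apply/idP/imsetP => [wK|[x]]; last by rewrite inE => xK ->.
    by have /imsetP[x _ ew] := subsetP KS w wK; exists x; rewrite // inE -ew.
  rewrite EK card_imset //; apply: (phiP m nm a) => [x y|x]; rewrite !inE.
    move=> xK yK nxy; have [|xy cxy] := mK _ _ xK yK; first by rewrite (inj_eq (embI m)).
    by rewrite (proj2 (embE m)) in xy.
  by move=> /Ka; rewrite gE.
exists (cone_colouring (S := S) (J := setT) c0 g); split; first exact: dS.
move=> a K m0K mK; apply: (dA a) => u v uK vK nuv; have [uv duv] := mK u v uK vK nuv.
split=> //; move: uv m0K uK vK {nuv duv}.
have mem x y : @adj (cone S setT) (inl x) (inr y) -> inr m0 \notin K -> inr y \in K ->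
    @adj (cone S [set~ m0]) (inl x) (inr y).
  move=> /= /andP[_ ->] m0K yK; rewrite andbT !inE.
  by apply: contraNneq m0K => <-.
case: u v => [x|m] [y|m'] //= xy nK uK vK.
  by apply: (mem x m').
by apply: (mem y m).
Qed.

End Assembly.

End Colourings.

(** * Complete graphs with good colourings *)

Section Product.
Variables (q t : nat) (V : finType) (c : colouring q.+1 (clique V)).
Hypothesis t_gt0 : 0 < t.

Definition product_colouring : colouring q.+2 (clique (V * 'I_t.-1)%type) :=
  fun u v => if u.2 == v.2 then lift ord_max (c u.1 v.1) else ord_max.

Lemma product_good : good t c -> good t product_colouring.
Proof.
move=> [cS cA]; split=> [u v|a A mA].
  by rewrite /product_colouring eq_sym cS.
have [b|] := unliftP ord_max a => ea; subst a.
  have sndA : {in A &, forall u v, u.2 = v.2}.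
    move=> u v uA vA; have [->//|nuv] := eqVneq u v.
    have [_] := mA u v uA vA nuv; rewrite /product_colouring.
    by case: eqP => // _ /eqP; rewrite (negPf (neq_lift _ _)).
  have fstI : {in A &, injective (@fst V 'I_t.-1)}.
    by move=> [x i] [y i'] uA vA /= ->; have /= -> := sndA _ _ uA vA.
  rewrite -(card_in_imset fstI); apply: (cA b) => _ _ /imsetP[u uA ->] /imsetP[v vA ->] ne.
  split=> //; have nuv : u != v by apply: contraNneq ne => ->.
  have [_] := mA u v uA vA nuv; rewrite /product_colouring (sndA u v) // eqxx.
  exact: lift_inj.
have sndI : {in A &, injective (@snd V 'I_t.-1)}.
  move=> u v uA vA euv; apply/eqP/negPn/negP => nuv.
  have [_ /eqP] := mA u v uA vA nuv; rewrite /product_colouring euv eqxx.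
  by rewrite eq_sym (negPf (neq_lift _ _)).
rewrite -(card_in_imset sndI); apply: leq_ltn_trans (max_card _) _.
by rewrite card_ord prednK.
Qed.

(** In each copy of [V] some edge to the new vertex must have the new colour
    [ord_max], since [c] is not extendable; these edges end in a clique of size
    [t - 1] in that colour. *)
Lemma product_not_extendable : ~ extendable t c -> ~ extendable t product_colouring.
Proof.
move=> nc [f fP].
have [w fw] : exists w : 'I_t.-1 -> V, forall i, f (w i, i) = ord_max.
  apply: (@fin_all_exists _ (fun=> V) (fun i v => f (v, i) = ord_max)) => i.
  apply: NNPP => no; apply: nc.
  exists (fun v => odflt ord0 (unlift ord_max (f (v, i)))) => a K mK Ka.
  have pI : injective (fun v : V => (v, i)) by move=> x y [].
  rewrite -(card_imset K pI); apply: (fP (lift ord_max a)).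
    move=> _ _ /imsetP[x xK ->] /imsetP[y yK ->] ne; split=> //.
    have [|_ <-] := mK x y xK yK; first by apply: contraNneq ne => ->.
    by rewrite /product_colouring eqxx.
  move=> _ /imsetP[x xK ->]; have := Ka x xK.
  by case: unliftP => [b -> /= ->//|fx]; case: no; exists x.
have wI : injective (fun i : 'I_t.-1 => (w i, i)) by move=> x y [].
have mono : mono_clique product_colouring ord_max [set (w i, i) | i in 'I_t.-1].
  move=> _ _ /imsetP[x _ ->] /imsetP[y _ ->] ne; split=> //.
  by rewrite /product_colouring /=; case: eqP => // e; rewrite e eqxx in ne.
have := fP _ _ mono; rewrite card_imset // card_ord prednK // ltnn => absurd.
by apply/notF/absurd => _ /imsetP[x _ ->].
Qed.

End Product.

(** With one colour, take the complete graph on [t - 1] vertices. *)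
Lemma lexicographic_pattern t : 0 < t -> forall q,
  exists (V : finType) (c : colouring q.+1 (clique V)),
    [/\ good t c, ~ extendable t c & #|V| = t.-1 ^ q.+1].
Proof.
move=> t_gt0; elim=> [|q [V [c [gc nc cV]]]]; last first.
  exists (V * 'I_t.-1)%type, (product_colouring (t := t) c); split.
  - exact: product_good.
  - exact: product_not_extendable.
  by rewrite card_prod card_ord cV -expnSr.
exists 'I_t.-1, (fun _ _ => ord0); split.
- split=> // a A _; apply: leq_ltn_trans (max_card _) _.
  by rewrite card_ord prednK.
- case=> f fP; have := fP ord0 setT; rewrite cardsT card_ord prednK // ltnn => absurd.
  by apply/notF/absurd => // x _; rewrite ord1.
by rewrite card_ord expn1.
Qed.

(** The product colourings live on [(t-1)^q] vertices.  One more vertex is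
    gained already for two colours, by a circulant colouring with [n = t - 1]:
    the second colour is used for pairs at circular distance at least [n]. *)
Section Circulant.
Variable n : nat.
Hypothesis n_gt1 : 1 < n.

Definition far_apart (i j : nat) := n <= (i - j) + (j - i) <= n ^ 2 + 1 - n.

Definition circulant_colouring : colouring 2 (clique 'I_(n ^ 2 + 1)) :=
  fun i j => if far_apart i j then ord_max else ord0.

(** Measured from the smallest vertex [i0] of a clique, the offsets of a clique of
    far pairs are spaced by at least [n] and stay below [n ^ 2], so they have distinct
    quotients by [n].  The offsets of a clique of near pairs are below [n] or
    above [n ^ 2 + 1 - n]; shifting the latter down by [n ^ 2 + 1 - n] makes no two
    offsets coincide, because vertices at that difference are far apart. *)
Lemma circulant_good : good n.+1 circulant_colouring.
Proof.
split=> [i j|a A mA]; first by rewrite /circulant_colouring /far_apart addnC.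
have [->|[x xA]] := set_0Vmem A; first by rewrite cards0.
case: (arg_minnP (fun i : 'I_(n ^ 2 + 1) => i : nat) xA) => i0 i0A i0min.
have n_gt0 : 0 < n by lia.
have nn : n ^ 2 = n * n by [].
have bound (g : nat -> nat) : (forall i, i \in A -> g (i - i0) < n) ->
    {in A &, forall i j : 'I__, i != j -> g (i - i0) != g (j - i0)} -> #|A| < n.+1.
  move=> gn gI; rewrite ltnS -[n in _ <= n]card_ord.
  have h (i : 'I_(n ^ 2 + 1)) : g (i - i0) %% n < n by rewrite ltn_mod.
  rewrite -(@card_in_imset _ _ (fun i => Ordinal (h i))) ?max_card //.
  move=> i j iA jA /(congr1 val) /=; rewrite !modn_small ?gn // => e.
  by apply/eqP/negPn/negP => /(gI i j iA jA); rewrite e eqxx.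
have colA i j : i \in A -> j \in A -> i != j -> far_apart i j = (a == ord_max).
  move=> iA jA nij; have [_ <-] := mA i j iA jA nij.
  by rewrite /circulant_colouring; case: ifP.
have [amax|nmax] := boolP (a == ord_max).
  have leA i : i \in A -> i - i0 <= n ^ 2 + 1 - n.
    move=> iA; have [->|ni] := eqVneq i i0; first by rewrite subnn.
    by have := colA i i0 iA i0A ni; rewrite amax /far_apart; lia.
  apply: (bound (fun d => d %/ n)) => [i iA|i j iA jA nij].
    by rewrite ltn_divLR // -nn; have := leA i iA; nia.
  apply/negP => /eqP e; have := colA i j iA jA nij; rewrite amax /far_apart.
  have := i0min i iA; have := i0min j jA.
  have := divn_eq (i - i0) n; have := divn_eq (j - i0) n; rewrite e.
  by have := ltn_pmod (i - i0) n_gt0; have := ltn_pmod (j - i0) n_gt0; lia.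
have near i j : i \in A -> j \in A -> i != j ->
    (i - j) + (j - i) < n \/ n ^ 2 + 1 - n < (i - j) + (j - i).
  by move=> iA jA nij; have := colA i j iA jA nij; rewrite (negPf nmax) /far_apart; lia.
have nbig : n + n <= n ^ 2 by rewrite nn; nia.
have lti i : i \in A -> i < n ^ 2 + 1 by move=> _; apply: ltn_ord.
apply: (bound (fun d => if d < n then d else d - (n ^ 2 + 1 - n))) => [i iA|i j iA jA nij].
  by have := lti i iA; case: ifP; lia.
have ne : (i : nat) <> j by move=> e; case/eqP: nij; apply: val_inj.
have := near i j iA jA nij; have := i0min i iA; have := i0min j jA.
have := lti i iA; have := lti j jA.
have nearo k : k \in A -> k - i0 < n \/ n ^ 2 + 1 - n < k - i0.
  move=> kA; have [->|nk] := eqVneq k i0; first by rewrite subnn; left.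
  by have := near k i0 kA i0A nk; have := i0min k kA; lia.
by have := nearo i iA; have := nearo j jA; do 2?case: ifP; lia.
Qed.

End Circulant.

Lemma big_clique_colourable t : 2 < t -> forall q,
  exists U : finType, colourable q.+2 t (clique U) /\ t.-1 ^ q.+2 < #|U|.
Proof.
move=> t_gt2; elim=> [|q [U [[c gc] ltU]]].
  have : colourable 2 t.-1.+1 (clique 'I_(t.-1 ^ 2 + 1)).
    by exists (@circulant_colouring t.-1); apply: circulant_good; lia.
  rewrite prednK; last by lia.
  by exists 'I_(t.-1 ^ 2 + 1); split=> //; rewrite card_ord addn1.
exists (U * 'I_t.-1)%type; split.
  by exists (product_colouring (t := t) c); apply: product_good => //; lia.
by rewrite card_prod card_ord expnSr ltn_pmul2r //; lia.
Qed.

(** The graph [A] and the new vertex together fit into a complete graph that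
    has a good colouring. *)
Lemma small_extendable q t (A : sgraph) : 1 < q -> 2 < t -> #|A| <= t.-1 ^ q ->
  exists c : colouring q A, good t c /\ extendable t c.
Proof.
move=> q_gt1 t_gt2 leA; case: q q_gt1 leA => [|[|q]] // _ leA.
have [U [cU ltU]] := big_clique_colourable t_gt2 q.
have [|c gc] := @colourable_clique_le _ _ (option A) U _ cU.
  by rewrite card_option; apply: leq_trans ltU.
exists (pull (Some : A -> clique (option A)) c); split.
  apply: good_pull gc => [x y [] //|x y xy]; rewrite /adj /= /clique_adj.
  by apply: contraTneq xy => -[->]; rewrite adj_irr.
exists (fun x => c None (Some x)) => a K mK Ka.
have SomeI : injective (@Some A) by move=> ? ? [].
pose SK : {set clique (option A)} := Some @: K.
have nK : None \notin SK by apply/negP => /imsetP[].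
have -> : #|K|.+1 = #|None |: SK| by rewrite cardsU1 nK card_imset.
apply: (proj2 gc a) => u v; rewrite !inE => uK vK nuv; split=> //.
have [cS _] := gc.
case/predU1P: uK nuv => [->|/imsetP[x xK ->]]; case/predU1P: vK => [->|/imsetP[y yK ->]] nuv.
- by rewrite eqxx in nuv.
- exact: Ka.
- by rewrite cS; apply: Ka.
by have [|_ <-] := mK x y xK yK; first by apply: contraNneq nuv => ->.
Qed.

(** * Ramsey graphs and minimal Ramsey graphs *)

Lemma ramsey_not_colourable q t (G : sgraph) : 0 < q ->
  ramsey q G (complete_graph t) -> ~ colourable q t G.
Proof.
move=> q_gt0 rG [c [cS cA]].
pose c' (S : {set G}) := if [pick u : G * G | S == [set u.1; u.2]] is Some u
  then c u.1 u.2 else Ordinal q_gt0.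
have c'E x y : c' [set x; y] = c x y.
  rewrite /c'; case: pickP => [[u v] /= /eqP/setP e|/(_ (x, y))]; last by rewrite eqxx.
  have := e x; have := e y; have := e u; have := e v.
  rewrite !inE !eqxx !orbT /= => vxy uxy /esym yuv /esym xuv.
  case/orP: uxy yuv xuv => /eqP->; case/orP: vxy => /eqP-> //; rewrite ?orbb.
  - by move=> /eqP->.
  - by move=> _ /eqP->.
have [S [[f [fB fA]] [a Sa]]] := rG c'.
pose A : {set G} := val @: [set: S].
have cardA : #|A| = t.
  rewrite card_imset; last exact: val_inj.
  by rewrite cardsT (bij_eq_card fB) card_ord.
have : #|A| < t; last by rewrite cardA ltnn.
apply: (cA a) => _ _ /imsetP[x _ ->] /imsetP[y _ ->] ne.
have xy : sub_adj S (val x) (val y).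
  have := fA x y; rewrite /adj /= => <-.
  by rewrite (bij_eq fB); apply: contraNneq ne => ->.
by split; [apply: sub_adj_adj xy | rewrite -c'E; apply: Sa].
Qed.

Lemma not_colourable_ramsey q t (G : sgraph) :
  ~ colourable q t G -> ramsey q G (complete_graph t).
Proof.
move=> nG c; apply: NNPP => noS; apply: nG.
exists (fun x y => c [set x; y]); split=> [x y|a A mA]; first by rewrite setUC.
rewrite ltnNge; apply/negP => leA; apply: noS.
have [|g gI gA] := @injection_into 'I_t G A; first by rewrite card_ord.
pose V := g @: [set: 'I_t].
pose e (x y : G) := [&& x \in V, y \in V & x != y].
have eS : symmetric e by move=> x y; rewrite /e andbCA eq_sym.
have VA x : x \in V -> x \in A by case/imsetP=> i _ ->.
have eA x y : e x y -> adj x y by case/and3P=> /VA xA /VA yA /(mA x y xA yA)[].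
have eV x y : e x y -> x \in V by case/and3P.
exists (Subgraph eS eA eV); split; last first.
  by exists a => x y /= /and3P[/VA xA /VA yA /(mA x y xA yA)[]].
have gV i : g i \in V by rewrite imset_f ?inE.
pose k (i : 'I_t) : {x : G | x \in V} := exist _ (g i) (gV i).
have kI : injective k by move=> i i' [] /gI.
have kB : bijective k.
  apply: inj_card_bij => //; rewrite card_sig card_ord.
  by rewrite (card_imset _ gI) cardsT card_ord.
have [f fK Kf] := kB.
exists f; split; first by exists k.
move=> x y /=; rewrite /adj /=.
have -> : (f x != f y) = (x != y) by rewrite (can_eq Kf).
have xV : val x \in V := valP x; have yV : val y \in V := valP y.
by rewrite /e xV yV /= (inj_eq val_inj).
Qed.

(** A measure that decreases when passing to a proper subgraph, whether
    vertices or edges are lost. *)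
Definition graph_size (G : sgraph) := #|G| + #|[set u : G * G | adj u.1 u.2]|.

Lemma proper_subgraph_size (G : sgraph) (S : subgraph G) :
  proper_subgraph S -> graph_size S < graph_size G.
Proof.
move=> pS; rewrite ltnNge; apply/negP => le; apply: pS.
pose E := [set u : G * G | sub_adj S u.1 u.2].
have cS : #|S| = #|sub_vertices S| by rewrite card_sig.
have cE : #|[set u : S * S | adj u.1 u.2]| <= #|E|.
  pose f (u : S * S) : G * G := (val u.1, val u.2).
  have fI : injective f by move=> [x y] [x' y'] [] /val_inj-> /val_inj->.
  rewrite -(card_imset _ fI); apply: subset_leq_card; apply/subsetP => _ /imsetP[u uE ->].
  by move: uE; rewrite !inE.
have sE : E \subset [set u : G * G | adj u.1 u.2].
  by apply/subsetP => u; rewrite !inE; apply: sub_adj_adj.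
have leE := subset_leq_card sE; have leV := max_card (sub_vertices S).
move: le; rewrite /graph_size cS => le.
split; first by apply/eqP; rewrite eqEcard subsetT cardsT; lia.
have /eqP EE : E == [set u : G * G | adj u.1 u.2] by rewrite eqEcard sE; lia.
by move=> x y; move/setP/(_ (x, y)): EE; rewrite !inE.
Qed.

Definition hom_inj (G H : sgraph) (h : G -> H) :=
  injective h /\ forall x y, adj x y -> adj (h x) (h y).

(** Subgraphs of subgraphs are avoided by recording an injective homomorphism,
    which is all that degrees and colourings need. *)
Lemma minimal_ramsey_exists q (G H : sgraph) : ramsey q G H ->
  exists (G' : sgraph) (h : G' -> G), minimal_ramsey q G' H /\ hom_inj h.
Proof.
have [n] := ubnP (graph_size G); elim: n G => // n IH G ltG rG.
have [mG|nmG] := classic (minimal_ramsey q G H); first by exists G, id; split=> //; split.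
have [S [pS rS]] : exists S : subgraph G, proper_subgraph S /\ ramsey q S H.
  by apply: NNPP => no; apply: nmG; split=> // S pS rS; apply: no; exists S.
have [|G' [h [mG' [hI hh]]]] := IH S _ rS.
  exact: leq_trans (proper_subgraph_size pS) ltG.
exists G', (fun x => val (h x)); split=> //; split; first by move=> x y /val_inj/hI.
by move=> x y /hh; apply: sub_adj_adj.
Qed.

Lemma degree_hom (G H : sgraph) (h : G -> H) x : hom_inj h -> degree x <= degree (h x).
Proof.
move=> [hI hh]; rewrite /degree -(card_imset _ hI); apply: subset_leq_card.
by apply/subsetP => w /imsetP[y]; rewrite inE => xy ->; rewrite inE; apply: hh.
Qed.

(** A subgraph that avoids [v] inherits the good colouring of the graph
    without [v]. *)
Lemma essential_in_image q t (G W : sgraph) (h : G -> W) v d :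
  hom_inj h -> ~ colourable q t G -> good_away (q := q) t v d -> exists x, h x = v.
Proof.
move=> [hI hh] nG [dS dA]; apply: NNPP => no; apply: nG.
exists (pull h d); split=> [x y|a K mK]; first exact: dS.
rewrite -(card_imset _ hI); apply: (dA a); last exact: mono_clique_image mK.
by apply/negP => /imsetP[x _ ev]; apply: no; exists x.
Qed.

Lemma vertex_essential q t (G : sgraph) (v : G) : 0 < q ->
  minimal_ramsey q G (complete_graph t) -> exists d, good_away (q := q) t v d.
Proof.
move=> q_gt0 [_ mG].
pose e (x y : G) := [&& adj x y, x != v & y != v].
have eS : symmetric e by move=> x y; rewrite /e adj_sym; congr (_ && _); rewrite andbC.
have eA x y : e x y -> adj x y by case/and3P.
have eV x y : e x y -> x \in [set~ v] by case/and3P => _; rewrite !inE.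
pose S := Subgraph eS eA eV.
have pS : proper_subgraph S by case=> /= /setP/(_ v); rewrite !inE eqxx.
have [c [cS cA]] : colourable q t S.
  by apply: NNPP => nS; apply: (mG S pS); apply: not_colourable_ramsey.
pose d (x y : G) := match insub x : option S, insub y : option S with
  | Some u, Some w => c u w | _, _ => Ordinal q_gt0 end.
exists d; split=> [x y|a K vK mK].
  by rewrite /d; case: (insub x) (insub y) => [u|] [w|].
have KS x : x \in K -> x \in [set~ v] by move=> xK; rewrite !inE; apply: contraNneq vK => <-.
have EK : K = val @: [set u : S | val u \in K].
  apply/setP=> x; apply/idP/imsetP => [xK|[u]]; last by rewrite inE => uK ->.
  by exists (exist _ x (KS x xK)); rewrite ?inE.
rewrite EK card_imset; last exact: val_inj.
apply: (cA a) => u w; rewrite !inE => uK wK nuw.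
have [|uw duw] := mK _ _ uK wK; first by rewrite (inj_eq val_inj).
split; last by rewrite /d !valK in duw.
by rewrite /adj /= /e uw /=; have := KS _ uK; have := KS _ wK; rewrite !inE => -> ->.
Qed.

Section Induced.
Variables (G : sgraph) (B : {set G}).

Definition induced_adj (x y : {x : G | x \in B}) := adj (val x) (val y).

Lemma induced_sym : symmetric induced_adj.
Proof. by move=> x y; apply: adj_sym. Qed.

Lemma induced_irr : irreflexive induced_adj.
Proof. by move=> x; apply: adj_irr. Qed.

Definition induced : sgraph := SGraph induced_sym induced_irr.

Lemma card_induced : #|induced| = #|B|.
Proof. by rewrite card_sig. Qed.

End Induced.

(** Minimality gives a good colouring away from [v]; an extension of its
    restriction to the neighbourhood would colour the edges at [v] as well. *)
Lemma neighbourhood_pattern q t (G : sgraph) (v : G) : 0 < q ->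
  minimal_ramsey q G (complete_graph t) ->
  exists c : colouring q (induced [set w | adj v w]), good t c /\ ~ extendable t c.
Proof.
move=> q_gt0 mG; have [d [dS dA]] := vertex_essential v q_gt0 mG.
pose N := induced [set w | adj v w].
have nG := ramsey_not_colourable q_gt0 (proj1 mG).
exists (pull (val : N -> G) d); split.
  split=> [x y|a K mK]; first exact: dS.
  rewrite -(card_imset K val_inj); apply: (dA a); last exact: mono_clique_image mK.
  apply/negP => /imsetP[x _ ev].
  have : val x \in [set w | adj v w] := valP x.
  by rewrite -ev inE adj_irr.
case=> f fP; apply: nG.
pose F (x : G) := if insub x : option N is Some u then f u else Ordinal q_gt0.
pose c (x y : G) := if x == v then F y else if y == v then F x else d x y.
exists c; split=> [x y|a K mK].
  by rewrite /c; case: (eqVneq x v) => [->|_]; case: (eqVneq y v) => // ->.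
have [vK|vK] := boolP (v \in K); last first.
  apply: (dA a) => // x y xK yK nxy; have [xy <-] := mK x y xK yK nxy.
  split=> //; rewrite /c; case: eqP => [e|_]; first by rewrite -e xK in vK.
  by case: eqP => // e; rewrite -e yK in vK.
have KN x : x \in K -> x != v -> x \in [set w | adj v w] /\ F x = a.
  move=> xK nx; have [vx cvx] := mK v x vK xK (contra_neq esym nx).
  by rewrite inE; split=> //; move: cvx; rewrite /c eqxx.
have nu (u : N) : val u != v.
  have : val u \in [set w | adj v w] := valP u.
  by rewrite inE; apply: contraTneq => ->; rewrite adj_irr.
pose K' : {set N} := [set u | val u \in K].
have EK : K :\ v = val @: K'.
  apply/setP=> x; apply/setD1P/imsetP => [[nx xK]|[u]].
    by have [xN _] := KN x xK nx; exists (exist _ x xN); rewrite ?inE.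
  by rewrite inE => uK ->; split.
rewrite (cardsD1 v) vK EK card_imset; last exact: val_inj.
apply: (fP a K') => [u w|u]; rewrite !inE.
  move=> uK wK nuw; have [|uw cuw] := mK _ _ uK wK; first by rewrite (inj_eq val_inj).
  by split=> //; move: cuw; rewrite /c !(negPf (nu _)).
by move=> uK; have [_] := KN _ uK (nu u); rewrite /F valK.
Qed.

(** * Abundance *)

(** Essential vertices lie in every Ramsey subgraph, where their degree can
    only be smaller. *)
Lemma minimal_ramsey_low_degrees q t (A : sgraph) (c : colouring q A) (k : nat) :
  1 < q -> 2 < t -> good t c -> ~ extendable t c -> #|A| <= t.-1 ^ q ->
  exists (G : sgraph) (w : 'I_k.+1 -> G),
    [/\ minimal_ramsey q G (complete_graph t), injective w & forall m, degree (w m) <= #|A|].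
Proof.
move=> q_gt1 t_gt2 gc nc leA; have [c' [gc' ec']] := small_extendable q_gt1 t_gt2 leA.
have [W [v [vI nW degv essv]]] := many_essential_vertices q_gt1 t_gt2 gc nc gc' ec' k.
have [G [h [mG hI]]] := minimal_ramsey_exists (not_colourable_ramsey nW).
have nG := ramsey_not_colourable (ltnW q_gt1) (proj1 mG).
have [w hw] : exists w : 'I_k.+1 -> G, forall m, h (w m) = v m.
  apply: (@fin_all_exists _ (fun=> G : Type) (fun m x => h x = v m)) => m.
  by have [d ed] := essv m; apply: essential_in_image hI nG ed.
exists G, w; split=> // [m m' e|m]; first by apply: vI; rewrite -!hw e.
by rewrite -(degv m) -hw degree_hom.
Qed.

Lemma is_min_exists (P : nat -> Prop) n : P n -> exists2 m, is_min P m & m <= n.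
Proof.
elim/ltn_ind: n => n IH Pn.
have [[m [Pm ltm]]|no] := classic (exists m, P m /\ m < n).
  by have [m' mm' le'] := IH m ltm Pm; exists m' => //; apply: leq_trans le' (ltnW ltm).
exists n => //; split=> // m Pm; rewrite leqNgt; apply/negP => ltm; apply: no.
by exists m.
Qed.

Lemma is_min_degree_exists (G : sgraph) (x : G) :
  exists2 d, is_min_degree G d & d <= degree x.
Proof. by apply: is_min_exists; exists x. Qed.

Theorem theorem1p4 (q t : nat) (hq : 2 <= q) (ht : 3 <= t) :
  s_abundant q (complete_graph t).
Proof.
have [q' eq] : exists q', q = q'.+1 by exists q.-1; rewrite prednK // ltnW.
have [V [c [gc nc cardV]]] := lexicographic_pattern (ltnW (ltnW ht)) q'.
have leV : #|clique V| <= t.-1 ^ q by rewrite cardV eq.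
rewrite -eq in c gc nc.
(* A first minimal Ramsey graph, which bounds the minimum degree wanted. *)
have [G1 [w1 [mG1 _ degw1]]] := minimal_ramsey_low_degrees 0 hq ht gc nc leV.
have [d1 d1min led1] := is_min_degree_exists (w1 ord0).
have [|s smin les] := @is_min_exists (fun d => exists G : sgraph,
    minimal_ramsey q G (complete_graph t) /\ is_min_degree G d) d1.
  by exists G1.
exists s; split=> // -[//|k] _.
have [[G0 [mG0 [[v degv] _]]] slow] := smin.
have [c0 [gc0 nc0]] := neighbourhood_pattern v (ltnW hq) mG0.
have cardA : #|induced [set w | adj v w]| = s by rewrite card_induced -degv.
have leA : #|induced [set w | adj v w]| <= t.-1 ^ q.
  rewrite cardA; apply: leq_trans les _; apply: leq_trans led1 _.
  exact: leq_trans (degw1 ord0) leV.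
have [G [w [mG wI degw]]] := minimal_ramsey_low_degrees k hq ht gc0 nc0 leA.
exists G; split=> //.
rewrite -[k.+1]card_ord -(card_codom wI); apply: subset_leq_card.
apply/subsetP => _ /codomP[m ->]; rewrite inE eqn_leq -{1}cardA degw /=.
have [d dmin led] := is_min_degree_exists (w m).
by apply: leq_trans led; apply: slow; exists G.
Qed.
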